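(* Let $H$ be a $v$-noetherian weakly Krull monoid with conductor $\mathfrak f=(H:\widehat H)$ satisfying $\emptyset\ne\mathfrak f\subsetneq H$, such that the localization $H_{\mathfrak p}$ is finitely primary for each $\mathfrak p\in\mathfrak X(H)$. Set $\mathcal P^*=\{\mathfrak p\in\mathfrak X(H)\mid\mathfrak p\supset\mathfrak f\}$ and suppose $\mathcal P=\mathfrak X(H)\setminus\mathcal P^*\neq\emptyset$. Let $G_{\mathcal P}\subset\mathcal C_v(H)$ denote the set of classes containing a minimal prime ideal from $\mathcal P$, and let $\pi:\mathfrak X(\widehat H)\to\mathfrak X(H)$ be the natural map defined by $\pi(\mathfrak P)=\mathfrak P\cap H$ for all $\mathfrak P\in\mathfrak X(\widehat H)$. 1. Suppose $\pi$ is bijective. If $\widehat{H_{\mathfrak p}}^{\times}/H_{\mathfrak p}^{\times}$ is finite for each $\mathfrak p\in\mathfrak X(H)$ and $\mathcal B(G_{\mathcal P})\ne\{1\}$, then $H$ is fully elastic. 2. Suppose $\pi$ is not bijective. If $H$ is seminormal and $G_{\mathcal P}=\mathcal C_v(H)$ is finite, then $\rho(H)=\infty$ and $H$ is fully elastic.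
   Context: A monoid is a commutative cancellative semigroup with identity, written multiplicatively; $\mathsf q(H)$ is the quotient group and $H^\times$ the unit group of $H$. Ideals. An $s$-ideal of $H$ is a subset $\mathfrak a\subset H$ with $\mathfrak aH=\mathfrak a$; it is prime if $H\setminus\mathfrak a$ is a submonoid. $\mathfrak X(H)$ is the set of minimal nonempty prime $s$-ideals. For $X\subset \mathsf q(H)$ let $(H:X)=\{x\in\mathsf q(H)\mid xX\subset H\}$ and $X_v=(H:(H:X))$; a $v$-ideal is a subset $\mathfrak a\subset H$ with $\mathfrak a_v=\mathfrak a$, and $v$-multiplication is $(\mathfrak a,\mathfrak b)\mapsto(\mathfrak a\mathfrak b)_v$. $H$ is $v$-noetherian if it satisfies the ascending chain condition on $v$-ideals. $\mathcal I_v^*(H)$ is the monoid of $v$-invertible $v$-ideals (with $v$-multiplication), $\mathcal F_v(H)^\times=\mathsf q(\mathcal I_v^*(H))$ is the group of fractional $v$-invertible $v$-ideals, and $\mathcal C_v(H)=\mathcal F_v(H)^\times/\{xH\mid x\in\mathsf q(H)\}$ is the $v$-class group. Closures. $\widehat H=\{a\in\mathsf q(H)\mid\text{there is }c\in H\text{ with }ca^n\in H\text{ for all }n\in\mathbb N\}$ is the complete integral closure; the conductor is $(H:\widehat H)=\{x\in\mathsf q(H)\mid x\widehat H\subset H\}$. $H$ is seminormal if $H=H'$, where $H'=\{a\in\mathsf q(H)\mid\text{there is }N\in\mathbb N\text{ with }a^n\in H\text{ for all }n\ge N\}$. $H$ is weakly Krull if $H=\bigcap_{\mathfrak p\in\mathfrak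 X(H)}H_{\mathfrak p}$ and $\{\mathfrak p\in\mathfrak X(H)\mid a\in\mathfrak p\}$ is finite for all $a\in H$. A monoid $D$ is finitely primary if there are $s,\alpha\in\mathbb N$ such that $D$ is a submonoid of a factorial monoid $F=F^\times\times[q_1,\dots,q_s]$ with $s$ pairwise non-associated primes $q_1,\dots,q_s$ satisfying $D\setminus D^\times\subset q_1\cdots q_sF$ and $(q_1\cdots q_s)^\alpha F\subset D$. Zero-sum sequences. For a subset $G_0$ of an additive abelian group $G$, $\mathcal F(G_0)$ is the free abelian monoid (written multiplicatively) with basis $G_0$, $\sigma:\mathcal F(G_0)\to G$ is the homomorphism with $\sigma(g)=g$ for $g\in G_0$, and $\mathcal B(G_0)=\{S\in\mathcal F(G_0)\mid\sigma(S)=0\}$. Arithmetic. An atom is a non-unit $u$ such that $u=ab$ implies $a\in H^\times$ or $b\in H^\times$. For a non-unit $a$, $\mathsf L(a)$ is the set of all $k\in\mathbb N$ such that $a$ is a product of $k$ atoms; $\mathsf L(a)=\{0\}$ for units; $\mathcal L(H)=\{\mathsf L(a)\mid a\in H\}$. In a $v$-noetherian monoid every non-unit is a product of atoms and all $\mathsf L(a)$ are finite. $\rho(L)=\max L/\min L$ for finite $L\subset\mathbb N$, $\rho(\{0\})=1$, and $\rho(H)=\sup\{\rho(L)\mid L\in\mathcal L(H)\}\in\mathbb R_{\ge1}\cup\{\infty\}$. $H$ is fully elastic if for every $q\in\mathbb Q$ with $1<q<\rho(H)$ there is $L\in\mathcal L(H)$ with $\rho(L)=q$. *)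

(* Defs.v *)
From HB Require Import structures.
From mathcomp Require Import all_boot all_order all_algebra.
From mathcomp Require Import finmap multiset.
From mathcomp Require Import all_classical all_reals ereal.

Set Implicit Arguments.
Unset Strict Implicit.
Unset Printing Implicit Defensive.

Local Open Scope classical_set_scope.
Local Open Scope group_scope.
Local Open Scope quotient_scope.

HB.mixin Record isCommutativeGroup G of Group G := {
  mulgC : @commutative G G *%g
}.

#[short(type="comGroupType")]
HB.structure Definition ComGroup := {G of isCommutativeGroup G & Group G}.

HB.instance Definition _ (G : comGroupType) :=
  SemiGroup.isCommutativeLaw.Build G *%g (@mulgC G).

(* A commutative cancellative monoid is represented inside its quotient group:
   G is an abelian group and H a submonoid of G with q(H) = G.  All notions
   below are relative to the ambient group G; they are only meant for
   submonoids H of G with q(H) = G.  Complete integral closures and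
   localizations of such an H are again of this form, with the same G. *)

Section Monoids.
Variable G : comGroupType.
Implicit Types (H A B X p D F : set G) (a b u x : G).

Definition submonoid H := H 1 /\ forall a b, H a -> H b -> H (a * b).

Definition quotient_group H : set G := [set a / b | a in H & b in H].

Definition units H : set G := [set u | H u /\ H u^-1].

Definition mulset A B : set G := [set a * b | a in A & b in B].

Definition s_ideal H A := A `<=` H /\ mulset A H = A.

Definition prime_s_ideal H p := s_ideal H p /\ submonoid (H `\` p).

Definition min_primes H : set (set G) :=
  [set p | [/\ prime_s_ideal H p, p !=set0 &
    forall q, prime_s_ideal H q -> q !=set0 -> q `<=` p -> q = p]].

Definition localization H p : set G := [set a / s | a in H & s in H `\` p].

Definition colon H X : set G := [set x | forall y, X y -> H (x * y)].

Definition v_closure H X : set G := colon H (colon H X).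

Definition v_ideal H A := A `<=` H /\ v_closure H A = A.

Definition v_noetherian H := forall A : nat -> set G,
  (forall n, v_ideal H (A n)) -> (forall n, A n `<=` A n.+1) ->
  exists N : nat, forall n, (N <= n)%N -> A n = A N.

Definition complete_integral_closure H : set G :=
  [set a | exists c, H c /\ forall n : nat, H (c * a ^+ n)].

Definition conductor H : set G := colon H (complete_integral_closure H).

Definition seminormalization H : set G :=
  [set a | exists N : nat, forall n, (N <= n)%N -> H (a ^+ n)].

Definition seminormal H := H = seminormalization H.

Definition weakly_Krull H :=
  H = \bigcap_(p in min_primes H) localization H p /\
  forall a, H a -> finite_set [set p | min_primes H p /\ p a].

Definition divides H a b := exists c, H c /\ b = a * c.

Definition prime_elt H (p : G) :=
  [/\ H p, ~ units H p &
    forall a b, H a -> H b ->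
      divides H p (a * b) -> divides H p a \/ divides H p b].

Definition associated H a b := exists u, units H u /\ b = a * u.

(* The factorial monoid F may be taken inside G = q(D): the inclusion
   (q_1...q_s)^alpha F `<=` D forces F `<=` q(D). *)
Definition finitely_primary D :=
  submonoid D /\
  exists (s alpha : nat) (F : set G) (q : 'I_s -> G),
    (0 < s)%N /\ (0 < alpha)%N /\
    submonoid F /\ D `<=` F /\
    (forall i, prime_elt F (q i)) /\
    (forall i j, associated F (q i) (q j) -> i = j) /\
    (* F = F^* x [q_1, ..., q_s] *)
    (forall x, F x -> exists! uk : G * {ffun 'I_s -> nat},
       units F uk.1 /\ x = uk.1 * \prod_(i < s) q i ^+ uk.2 i) /\
    D `\` units D `<=` mulset [set \prod_(i < s) q i] F /\
    mulset [set (\prod_(i < s) q i) ^+ alpha] F `<=` D.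

Definition atom H u :=
  [/\ H u, ~ units H u &
    forall a b, H a -> H b -> u = a * b -> units H a \/ units H b].

Definition lengths H a : set nat :=
  [set k | (units H a /\ k = 0%N) \/
           [/\ ~ units H a, (0 < k)%N &
             exists u : 'I_k -> G,
               (forall i, atom H (u i)) /\ a = \prod_(i < k) u i]].

Definition system_of_lengths H : set (set nat) := [set lengths H a | a in H].

(* cosets of B in A, for subgroups B `<=` A of G *)
Definition cosets A B : set (set G) := [set mulset [set a] B | a in A].

End Monoids.

(* For L nonempty and finite, which is the case for the sets of lengths of a
   v-noetherian monoid; max and min are the default value 0 otherwise. *)
Definition set_max (L : set nat) : nat :=
  xget 0%N [set m | L m /\ forall k, L k -> (k <= m)%N].
Definition set_min (L : set nat) : nat :=
  xget 0%N [set m | L m /\ forall k, L k -> (m <= k)%N].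

Definition elasticity_of_set (L : set nat) : rat :=
  if `[< L = [set 0%N] >] then 1%R else ((set_max L)%:R / (set_min L)%:R)%R.

Definition elasticity (R : realType) (G : comGroupType) (H : set G) : \bar R :=
  ereal_sup
    [set (ratr (elasticity_of_set L))%:E | L in system_of_lengths H]%E.

Definition fully_elastic (R : realType) (G : comGroupType) (H : set G) :=
  forall q : rat, (1 < q)%R -> ((ratr q)%:E < elasticity R H)%E ->
    exists L, system_of_lengths H L /\ elasticity_of_set L = q.

(* The free abelian monoid F(G0) is the monoid of multisets over A with support
   in G0; its identity 1 is mset0. *)
Definition zero_sum_sequences (A : zmodType) (G0 : set A) : set {mset A}%mset :=
  [set S : {mset A}%mset | (forall g, g \in S -> G0 g) /\ (\sum_(g <- S) g = 0)%R].

Section VInvertible.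
Variable G : comGroupType.
Implicit Types (H A B J K X Y : set G).

Lemma mulsetC A B : mulset A B = mulset B A.
Proof.
apply/seteqP; split => z [a Aa [b Bb <-]]; exists b => //; exists a => //;
exact: mulgC.
Qed.

Lemma mulsetA A B X : mulset A (mulset B X) = mulset (mulset A B) X.
Proof.
apply/seteqP; split => z.
  move=> [a Aa [y [b Bb [x Xx <-]] <-]]; exists (a * b); first by exists a => //; exists b.
  by exists x; rewrite // -mulgA.
move=> [y [a Aa [b Bb <-]] [x Xx <-]]; exists a => //; exists (b * x).
  by exists b => //; exists x.
by rewrite mulgA.
Qed.

Lemma mul1set A : mulset [set 1] A = A.
Proof.
apply/seteqP; split => [z [_ -> [a Aa <-]]|a Aa]; first by rewrite mul1g.
by exists 1 => //; exists a; rewrite ?mul1g.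
Qed.

Lemma colonS H X Y : X `<=` Y -> colon H Y `<=` colon H X.
Proof. by move=> XY x Hx y /XY; exact: Hx. Qed.

Lemma sub_v_closure H X : X `<=` v_closure H X.
Proof. by move=> x Xx y; rewrite mulgC; apply. Qed.

Lemma v_closureS H X Y : X `<=` Y -> v_closure H X `<=` v_closure H Y.
Proof. by move=> XY; do 2 apply: colonS. Qed.

Lemma colon_v_closure H X : colon H (v_closure H X) = colon H X.
Proof.
by apply/seteqP; split; [apply: colonS; exact: sub_v_closure | exact: sub_v_closure].
Qed.

Lemma v_closureK H X : v_closure H (v_closure H X) = v_closure H X.
Proof. by rewrite {1}/v_closure colon_v_closure. Qed.

Lemma colon_mulset H X Y : colon H (mulset X Y) = colon (colon H X) Y.
Proof.
apply/seteqP; split => z zH.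
  move=> y Yy x Xx; rewrite -mulgA; apply: zH.
  by exists x => //; exists y => //; exact: mulgC.
by move=> _ [x Xx [y Yy <-]]; rewrite (mulgC x) mulgA; apply: zH.
Qed.

Lemma v_closure_mull H X Y :
  v_closure H (mulset (v_closure H X) Y) = v_closure H (mulset X Y).
Proof. by rewrite {1}/v_closure colon_mulset colon_v_closure -colon_mulset. Qed.

Lemma v_closure_mulr H X Y :
  v_closure H (mulset X (v_closure H Y)) = v_closure H (mulset X Y).
Proof. by rewrite mulsetC v_closure_mull mulsetC. Qed.

Section Submonoid.
Variables (H : set G) (Hmon : submonoid H).

Lemma colon_id : colon H H = H.
Proof.
apply/seteqP; split => x; first by move/(_ 1 (proj1 Hmon)); rewrite mulg1.
by move=> Hx y; exact: (proj2 Hmon).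
Qed.

Lemma v_closure_id : v_closure H H = H.
Proof. by rewrite /v_closure !colon_id. Qed.

Lemma v_closure_unit J : v_closure H (mulset H J) = v_closure H J.
Proof. by rewrite /v_closure colon_mulset colon_id. Qed.

End Submonoid.

Definition principal H x := mulset [set x] H.

Lemma principalM H x y : submonoid H ->
  mulset (principal H x) (principal H y) = principal H (x * y).
Proof.
move=> Hm; apply/seteqP; split => z.
  move=> [_ [_ -> [a Ha <-]] [_ [_ -> [b Hb <-]] <-]].
  exists (x * y) => //; exists (a * b); first exact: (proj2 Hm).
  by rewrite -!mulgA; congr (_ * _); rewrite !mulgA (mulgC a).
move=> [_ -> [a Ha <-]]; exists (x * a); first by exists x => //; exists a.
exists (y * 1); first by exists y => //; exists 1 => //; exact: (proj1 Hm).
by rewrite mulg1 -!mulgA (mulgC a).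
Qed.

Lemma principal1 H : principal H 1 = H. Proof. exact: mul1set. Qed.

Definition fractional_v_ideal H J :=
  (exists c, H c /\ mulset [set c] J `<=` H) /\ v_closure H J = J.

Definition v_invertible H J :=
  exists K, fractional_v_ideal H K /\ v_closure H (mulset J K) = H.

Section Group.
Variable H : set G.
Hypotheses (Hmon : submonoid H) (Hquo : quotient_group H = setT).

Let frac (x : G) : exists a b, [/\ H a, H b & x * b = a].
Proof.
have : quotient_group H x by rewrite Hquo.
by move=> [a Ha [b Hb <-]]; exists a, b; rewrite mulgVK.
Qed.

Lemma fractional_v_ideal_mul J K :
  fractional_v_ideal H J -> fractional_v_ideal H K ->
  fractional_v_ideal H (v_closure H (mulset J K)).
Proof.
move=> [[c [Hc cJ]] vJ] [[d [Hd dK]] vK]; split; last exact: v_closureK.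
exists (c * d); split; first exact: (proj2 Hmon).
have cd : colon H (v_closure H (mulset J K)) (c * d).
  rewrite colon_v_closure => _ [j Jj [k Kk <-]].
  have -> : c * d * (j * k) = (c * j) * (d * k).
    by rewrite -!mulgA; congr (_ * _); rewrite !mulgA (mulgC d).
  apply: (proj2 Hmon); first by apply: cJ; exists c => //; exists j.
  by apply: dK; exists d => //; exists k.
by move=> _ [_ -> [y Yy <-]]; apply: cd.
Qed.

Lemma fractional_principal x : fractional_v_ideal H (principal H x).
Proof.
have [a [b [Ha Hb xb]]] := frac x; split.
  exists b; split=> // _ [_ -> [_ [_ -> [h Hh <-]] <-]].
  by rewrite mulgA (mulgC b) xb; exact: (proj2 Hmon).
have E z : colon H (principal H z) = principal H z^-1.
  apply/seteqP; split => w.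
    move=> /(_ z) Hw; exists z^-1 => //; exists (w * z).
      by apply: Hw; exists z => //; exists 1; rewrite ?mulg1 //; exact: (proj1 Hmon).
    by rewrite (mulgC w) mulKg.
  move=> [_ -> [h Hh <-]] _ [_ -> [k Hk <-]].
  by rewrite (mulgC _ h) -mulgA mulKg; exact: (proj2 Hmon).
by rewrite /v_closure !E invgK.
Qed.

Lemma v_invertible_principal x : v_invertible H (principal H x).
Proof.
exists (principal H x^-1); split; first exact: fractional_principal.
by rewrite principalM // mulgV principal1 v_closure_id.
Qed.

Lemma v_invertible_mul J K : v_invertible H J -> v_invertible H K ->
  v_invertible H (v_closure H (mulset J K)).
Proof.
move=> [J' [fJ' JJ']] [K' [fK' KK']].
exists (v_closure H (mulset J' K')); split; first exact: fractional_v_ideal_mul.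
rewrite v_closure_mull v_closure_mulr.
have -> : mulset (mulset J K) (mulset J' K') = mulset (mulset J J') (mulset K K').
  by rewrite -!mulsetA; congr mulset; rewrite !mulsetA (mulsetC K).
by rewrite -v_closure_mull JJ' v_closure_unit // KK'.
Qed.

Lemma v_inverse J : v_invertible H J -> fractional_v_ideal H J ->
  [/\ fractional_v_ideal H (colon H J), v_invertible H (colon H J) &
      v_closure H (mulset J (colon H J)) = H].
Proof.
move=> [K [fK JK]] fJ.
have KJ : K `<=` colon H J.
  move=> k Kk j Jj; rewrite -[X in X _]JK mulgC; apply: sub_v_closure.
  by exists j => //; exists k.
have inv : v_closure H (mulset J (colon H J)) = H.
  apply/seteqP; split.
    rewrite -[X in _ `<=` X]v_closure_id //; apply: v_closureS.
    by move=> _ [j Jj [k Kk <-]]; rewrite mulgC; exact: Kk.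
  rewrite -[X in X `<=` _]JK; apply: v_closureS.
  by move=> _ [j Jj [k Kk <-]]; exists j => //; exists k => //; exact: KJ.
split=> //; last by exists J; split=> //; rewrite mulsetC.
split; last by rewrite /v_closure -/(v_closure H J) fJ.2.
have [j Jj] : J !=set0.
  apply: contrapT => J0; apply: (J0); exists 1; rewrite -fJ.2.
  have JK0 : mulset J K = J.
    by apply/seteqP; split => [t [i Ji _]|i Ji]; case: J0; exists i.
  by rewrite -JK0 JK; exact: (proj1 Hmon).
have [a [b [Ha Hb jb]]] := frac j; exists a; split=> // _ [_ -> [k kJ <-]].
by rewrite -jb (mulgC j) -mulgA (mulgC j); apply: (proj2 Hmon) => //; exact: kJ.
Qed.

End Group.
End VInvertible.

Record monoid_in (G : comGroupType) := MonoidIn {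
  carrier :> set G;
  carrier_submonoid : submonoid carrier;
  carrier_quotient : quotient_group carrier = setT
}.

(* F_v(H)^x, the group of v-invertible fractional v-ideals of H *)
Section FractionalIdeals.
Variables (G : comGroupType) (H : monoid_in G).

Record v_ideal_group := VIdeal {
  videal_set :> set G;
  videal_fractional : fractional_v_ideal H videal_set;
  videal_invertible : v_invertible H videal_set
}.

Lemma videal_inj (I J : v_ideal_group) :
  videal_set I = videal_set J -> I = J.
Proof.
case: I J => [I fI iI] [J fJ iJ] /= E; subst J.
by rewrite (Prop_irrelevance fI fJ) (Prop_irrelevance iI iJ).
Qed.

HB.instance Definition _ := gen_eqMixin v_ideal_group.
HB.instance Definition _ := gen_choiceMixin v_ideal_group.

Let Hmon := carrier_submonoid H.
Let Hquo := carrier_quotient H.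

Definition principal_videal (x : G) : v_ideal_group :=
  VIdeal (fractional_principal Hmon Hquo x) (v_invertible_principal Hmon Hquo x).

Definition videal_one := principal_videal 1.

Definition videal_mul (I J : v_ideal_group) : v_ideal_group :=
  VIdeal
    (fractional_v_ideal_mul Hmon (videal_fractional I) (videal_fractional J))
    (v_invertible_mul Hmon (videal_invertible I) (videal_invertible J)).

Lemma videal_inverse (I : v_ideal_group) :
  [/\ fractional_v_ideal H (colon H I), v_invertible H (colon H I) &
      v_closure H (mulset I (colon H I)) = H].
Proof. exact: v_inverse (videal_invertible I) (videal_fractional I). Qed.

Definition videal_inv (I : v_ideal_group) : v_ideal_group :=
  let: And3 f i _ := videal_inverse I in VIdeal f i.

Lemma videal_invE I : videal_inv I = colon H I :> set G.
Proof. by rewrite /videal_inv; case: videal_inverse. Qed.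

Lemma videal_mulC : commutative videal_mul.
Proof. by move=> I J; apply: videal_inj; rewrite /= mulsetC. Qed.

Lemma videal_mulA : associative videal_mul.
Proof.
move=> I J K; apply: videal_inj => /=.
by rewrite v_closure_mulr v_closure_mull mulsetA.
Qed.

Lemma videal_mul1 : left_id videal_one videal_mul.
Proof.
move=> I; apply: videal_inj => /=.
by rewrite principal1 v_closure_unit // (videal_fractional I).2.
Qed.

Lemma videal_mulr1 : right_id videal_one videal_mul.
Proof. by move=> I; rewrite videal_mulC videal_mul1. Qed.

Lemma videal_mulrV : right_inverse videal_one videal_inv videal_mul.
Proof.
move=> I; apply: videal_inj => /=.
by rewrite videal_invE principal1; case: (videal_inverse I).
Qed.

Lemma videal_mulV : left_inverse videal_one videal_inv videal_mul.
Proof. by move=> I; rewrite videal_mulC videal_mulrV. Qed.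

HB.instance Definition _ := isGroup.Build v_ideal_group
  videal_mulA videal_mul1 videal_mulr1 videal_mulV videal_mulrV.
HB.instance Definition _ := isCommutativeGroup.Build v_ideal_group videal_mulC.

Lemma principal_videalM x y :
  principal_videal (x * y) = principal_videal x * principal_videal y.
Proof.
apply: videal_inj; rewrite /= principalM //.
by rewrite (fractional_principal Hmon Hquo (x * y)).2.
Qed.

Lemma principal_videal1 : principal_videal 1 = 1.
Proof. by []. Qed.

Lemma principal_videalV x : principal_videal x^-1 = (principal_videal x)^-1.
Proof.
apply: (can_inj (mulKg (principal_videal x))).
by rewrite -principal_videalM !mulgV principal_videal1.
Qed.

(* C_v(H), the quotient of F_v(H)^x by the principal ideals, written
   additively *)
Definition class_equiv (I J : v_ideal_group) : bool :=
  `[< exists x, I / J = principal_videal x >].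

Lemma class_equiv_is_equiv : equiv_class_of class_equiv.
Proof.
split=> [I|I J|J I K].
- by apply/asboolP; exists 1; rewrite mulgV.
- by apply/idP/idP => /asboolP[x E]; apply/asboolP; exists x^-1;
    rewrite principal_videalV -E invgM invgK.
- move=> /asboolP[x E] /asboolP[y E']; apply/asboolP; exists (x * y).
  by rewrite principal_videalM -E -E' mulgA mulgVK.
Qed.

Canonical class_equiv_equiv := EquivRelPack class_equiv_is_equiv.

Definition v_class_group := {eq_quot class_equiv}.

HB.instance Definition _ := Choice.on v_class_group.
HB.instance Definition _ := EqQuotient.on v_class_group.

Definition v_class (I : v_ideal_group) : v_class_group := \pi I.

Lemma v_classP I J :
  v_class I = v_class J <-> exists x, I / J = principal_videal x.
Proof.
by split=> [/eqquotP/asboolP//|E]; apply/eqquotP/asboolP.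
Qed.

Definition class_zero : v_class_group := v_class 1.
Definition class_opp (C : v_class_group) := v_class (repr C)^-1.
Definition class_add (C D : v_class_group) := v_class (repr C * repr D).

Lemma v_class_repr C : v_class (repr C) = C.
Proof. exact: reprK. Qed.

Lemma v_classM I J : v_class (I * J) = class_add (v_class I) (v_class J).
Proof.
have /v_classP[x Ex] := v_class_repr (v_class I).
have /v_classP[y Ey] := v_class_repr (v_class J).
apply/esym/v_classP; exists (x * y).
rewrite principal_videalM -Ex -Ey invgM -!mulgA; congr (_ * _).
by rewrite !mulgA mulgC !mulgA (mulgC _ (repr _)).
Qed.

Lemma v_classV I : v_class I^-1 = class_opp (v_class I).
Proof.
have /v_classP[x Ex] := v_class_repr (v_class I).
apply/v_classP; exists x; rewrite -Ex invgK; exact: mulgC.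
Qed.

Lemma class_addA : associative class_add.
Proof.
move=> C D E; rewrite -[C]v_class_repr -[D]v_class_repr -[E]v_class_repr.
by rewrite -!v_classM mulgA.
Qed.

Lemma class_addC : commutative class_add.
Proof. by move=> C D; rewrite /class_add mulgC. Qed.

Lemma class_add0 : left_id class_zero class_add.
Proof. by move=> C; rewrite -[C]v_class_repr -v_classM mul1g. Qed.

Lemma class_addN : left_inverse class_zero class_opp class_add.
Proof. by move=> C; rewrite -[C]v_class_repr -v_classV -v_classM mulVg. Qed.

HB.instance Definition _ := GRing.isZmodule.Build v_class_group
  class_addA class_addC class_add0 class_addN.

Definition classes_of (P : set (set G)) : set v_class_group :=
  [set C | exists I : v_ideal_group, P I /\ v_class I = C].

End FractionalIdeals.

Arguments v_class_group {G} H.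
Arguments v_ideal_group {G} H.
Arguments classes_of {G} H P.

(* Main.v *)
(* For each minimal prime p of H, let v_{p,i} (i < s_p) be the valuations of the
   factorial overmonoid of H_p; H is cut out by its localizations and the
   complete integral closure of H by the v_{p,i} >= 0, so pi is bijective iff all
   s_p = 1.  At a prime not containing the conductor, H_p is the monoid v >= 0.

   Part 1.  Over finitely many primes, divisibility is a well-quasi-order, so
   only finitely many atoms occur up to units.  Choose a with rho(L(a)) > q and
   an atom A all of whose powers factor uniquely.  Among the products a^m A^n
   with two factorizations whose lengths are in ratio exactly q, one maximizes
   n/m (Dickson's lemma).  Its maximal and minimal length have ratio q: otherwise
   a suitable power could absorb more copies of A.

   Part 2.  At a prime p0 of rank at least 2, seminormality makes every x with
   all v_{p0,i}(x) > 0 an element of H_{p0}.  If c has the minimal value mu of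
   v_{p0,0} among nonunits supported at p0, an atom a with v_{p0,0}(a) = mu and
   the other valuations large, and an atom b with v_{p0,0}(b) = (n-1) mu and
   v_{p0,1}(b) = 1, give min L(ab) = 2 and max L(ab) = n.  Multiplying by powers
   of a prime element, which exists since the trivial class contains a prime of
   P, realizes every ratio. *)

Require Import Defs.
From mathcomp Require Import all_boot all_order all_algebra.
From mathcomp Require Import finmap multiset.
From mathcomp Require Import all_classical all_reals ereal.
From mathcomp Require Import zify ring.

Set Implicit Arguments.
Unset Strict Implicit.
Unset Printing Implicit Defensive.

Local Open Scope classical_set_scope.
Local Open Scope group_scope.

(** Extremal lengths are not additive, so exponents m, n giving the ratio q cannot simply be solved
    for. Part 1 therefore works with exponent vectors recording a product of powers of a and A
    together with two factorizations, not necessarily extremal, of length ratio exactly q. Their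
    defining conditions are multiplicative, hence stable under differences, and this yields a
    steepest vector. The choice of A enters here: a nontrivial power of A has only one length, so it
    cannot carry two lengths of ratio q > 1, and no vector has infinite slope.

    In Part 2, elements with prescribed valuations at p0 must involve other primes as little as
    possible. Finiteness of the class group gives elements supported at p0, but only up to powers;
    the exact valuations required of b cost one further prime of P, taken in the opposite class. It
    divides b to first order, so in every factorization of ab one side is supported at p0, where
    v_{p0,0} takes multiples of mu. As b is an atom, every nonunit divisor of ab then has v_{p0,0}
    at least mu, which bounds the lengths by n. *)

Section AbelianWords.
Variable G : comGroupType.

(* Reflexive decision of identities in a commutative group: two words agree as
   soon as all exponents do; inverses are moved across the equality, so
   [word_exp true] and [word_exp false] count the occurrences of a variable with
   exponent 1 and with exponent -1. *)
Inductive word := WOne | WVar of nat | WMul of word & word | WInv of word.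

Fixpoint word_eval (env : seq G) w : G :=
  match w with
  | WOne => 1
  | WVar i => nth 1 env i
  | WMul u v => word_eval env u * word_eval env v
  | WInv u => (word_eval env u)^-1
  end.

Fixpoint word_exp (b : bool) w (i : nat) : nat :=
  match w with
  | WOne => 0%N
  | WVar j => ((i == j) && b : nat)
  | WMul u v => (word_exp b u i + word_exp b v i)%N
  | WInv u => word_exp (~~ b) u i
  end.

Fixpoint word_size w : nat :=
  match w with
  | WOne => 0%N
  | WVar j => j.+1
  | WMul u v => maxn (word_size u) (word_size v)
  | WInv u => word_size u
  end.

Definition word_prod env n b w : G :=
  \prod_(i < n) nth 1 env i ^+ word_exp b w i.

Lemma expgMC (x y : G) n : (x * y) ^+ n = x ^+ n * y ^+ n.
Proof. by apply: expgMn; exact: mulgC. Qed.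

Lemma mulgACA (x y z t : G) : (x * y) * (z * t) = (x * z) * (y * t).
Proof. by rewrite -!mulgA; congr (_ * _); rewrite !mulgA (mulgC y). Qed.

Lemma mulgCA (x y z : G) : x * (y * z) = y * (x * z).
Proof. by rewrite !mulgA (mulgC x). Qed.

Lemma invgMC (x y : G) : (x * y)^-1 = x^-1 * y^-1.
Proof. by rewrite invgM mulgC. Qed.

Lemma prodgMC (I : Type) (r : seq I) (P : pred I) (f g : I -> G) :
  \prod_(i <- r | P i) (f i * g i) =
  \prod_(i <- r | P i) f i * \prod_(i <- r | P i) g i.
Proof.
elim/big_rec3: _ => [|i x y z _ ->]; first by rewrite mulg1.
by rewrite mulgACA.
Qed.

Lemma word_evalE env n w : (word_size w <= n)%N ->
  word_eval env w = word_prod env n true w / word_prod env n false w.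
Proof.
rewrite /word_prod; elim: w => [|j|u IHu v IHv|u IHu] /=.
- by move=> _; rewrite !big1 ?mulgV.
- move=> jn; rewrite [X in _ / X]big1; last by move=> i _; rewrite andbF.
  rewrite invg1 mulg1 (bigD1_seq (Ordinal jn)) ?index_enum_uniq ?mem_index_enum //=.
  by rewrite eqxx big1 ?mulg1 // => i; rewrite -val_eqE /= => /negPf->.
- rewrite geq_max => /andP[/IHu-> /IHv->].
  have E b : \prod_(i < n) nth 1 env i ^+ (word_exp b u i + word_exp b v i)%N =
    \prod_(i < n) nth 1 env i ^+ word_exp b u i *
    \prod_(i < n) nth 1 env i ^+ word_exp b v i.
    by rewrite -prodgMC; apply: eq_bigr => i _; rewrite expgnDr.
  by rewrite !E invgMC mulgACA.
- by move=> /IHu->; rewrite invgM invgK.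
Qed.

Lemma word_eqP env n u v :
  all (fun i => (word_exp true u i + word_exp false v i ==
                 word_exp true v i + word_exp false u i)%N) (iota 0 n) ->
  (word_size u <= n)%N -> (word_size v <= n)%N ->
  word_eval env u = word_eval env v.
Proof.
move=> /allP E /(word_evalE env)-> /(word_evalE env)->.
have {}E : word_prod env n true u * word_prod env n false v =
           word_prod env n true v * word_prod env n false u.
  rewrite -!prodgMC; apply: eq_bigr => i _; rewrite -!expgnDr.
  by rewrite (eqP (E i _)) ?mem_iota ?add0n ?ltn_ord.
apply: (mulIg (word_prod env n false v)); rewrite mulgVK.
by rewrite mulgC mulgA [X in X / _]mulgC E mulgK.
Qed.

End AbelianWords.

(* Variables are compared up to conversion, as the same element may occur with
   different inferred structures on its type. *)
Ltac word_mem x l :=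
  match l with
  | nil => constr:(false)
  | cons ?y _ => let _ := constr:(erefl x : x = y) in constr:(true)
  | cons _ ?l' => word_mem x l'
  end.

Ltac word_index x l :=
  match l with
  | cons ?y _ => let _ := constr:(erefl x : x = y) in constr:(O)
  | cons _ ?l' => let n := word_index x l' in constr:(S n)
  end.

Ltac word_vars t l :=
  lazymatch t with
  | (?x * ?y)%g => let l' := word_vars x l in word_vars y l'
  | (?x^-1)%g => word_vars x l
  | 1%g => l
  | _ => let b := word_mem t l in
         lazymatch b with true => l | false => constr:(cons t l) end
  end.

Ltac word_reify t l :=
  lazymatch t with
  | (?x * ?y)%g => let u := word_reify x l in let v := word_reify y l in
                   constr:(WMul u v)
  | (?x^-1)%g => let u := word_reify x l in constr:(WInv u)
  | 1%g => constr:(WOne)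
  | _ => let n := word_index t l in constr:(WVar n)
  end.

Ltac abelg :=
  lazymatch goal with
  | |- ?x = ?y :> ?T =>
    let l := word_vars x (@nil T) in
    let l := word_vars y l in
    let u := word_reify x l in
    let v := word_reify y l in
    apply: (@word_eqP _ l (size l) u v); vm_compute; reflexivity
  end.

(** * Well-quasi-orders and vectors of maximal slope *)

Section WellQuasiOrders.
Variable T : Type.
Implicit Types (R : T -> T -> Prop) (S : set T).

(** Asking for a whole subsequence instead of one good pair makes conjunctions immediate: pass to a
    subsequence twice. *)
Definition wqo_on S R := forall f : nat -> T, (forall n, S (f n)) ->
  exists g : nat -> nat, (forall i j, i < j -> g i < g j)%N /\
    forall i j, (i < j)%N -> R (f (g i)) (f (g j)).

Lemma wqo_true S : wqo_on S (fun _ _ => True).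
Proof. by move=> f _; exists id; split. Qed.

Lemma wqo_and S R R' : wqo_on S R -> wqo_on S R' ->
  wqo_on S (fun x y => R x y /\ R' x y).
Proof.
move=> wR wR' f Sf; have [g [gm Rg]] := wR f Sf.
have [h [hm Rh]] := wR' (f \o g) (fun n => Sf _).
exists (g \o h); split=> i j ij /=; first by apply: gm; apply: hm.
by split; [apply: Rg; apply: hm | apply: Rh].
Qed.

Lemma wqo_sub S R R' : (forall x y, S x -> S y -> R x y -> R' x y) ->
  wqo_on S R -> wqo_on S R'.
Proof.
move=> RR' wR f Sf; have [g [gm Rg]] := wR f Sf.
by exists g; split=> // i j ij; apply: RR' => //; exact: Rg.
Qed.

Lemma wqo_all (I : eqType) (r : seq I) S (R : I -> T -> T -> Prop) :
  (forall i, i \in r -> wqo_on S (R i)) ->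
  wqo_on S (fun x y => forall i, i \in r -> R i x y).
Proof.
elim: r => [|a r IHr] wR; first exact: wqo_sub (@wqo_true S).
have w1 : wqo_on S (R a) by apply: wR; rewrite mem_head.
have w2 := IHr (fun i ir => wR i (mem_behead (s := a :: r) ir)).
apply: wqo_sub (wqo_and w1 w2) => x y _ _ [Ra Rr] i.
by rewrite inE => /orP[/eqP->|/Rr].
Qed.

(** Each new index minimizes [w] over the entire remaining tail, so all later values are at least as
    large. *)
Lemma wqo_nat S (w : T -> nat) : wqo_on S (fun x y => w x <= w y)%N.
Proof.
move=> f _.
have tail_min n : exists m, (n <= m)%N /\
  forall k, (m <= k)%N -> (w (f m) <= w (f k))%N.
  have ex : exists d, `[< exists m, (n <= m)%N /\ w (f m) = d >].
    by exists (w (f n)); apply/asboolP; exists n.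
  have := ex_minnP ex; case=> d /asboolP[m [nm <-]] dmin.
  exists m; split=> // k mk; apply: dmin; apply/asboolP; exists k.
  by split=> //; exact: leq_trans mk.
have [h hP] := choice tail_min.
pose g n := iter n (fun m => h m.+1) (h 0%N).
exists g.
have gS n : (g n < g n.+1)%N by exact: (hP (g n).+1).1.
have gm i j : (i < j)%N -> (g i < g j)%N.
  elim: j => // j IHj; rewrite ltnS leq_eqVlt => /orP[/eqP->//|/IHj ij].
  exact: ltn_trans ij (gS j).
split=> // i j /gm /ltnW gij; case: i gij => [|i] gij; first exact: (hP _).2.
exact: (hP _).2.
Qed.

(** The pigeonhole principle in this language: along a common subsequence both [w] and [N - w] are
    nondecreasing. *)
Lemma wqo_eq_nat S (w : T -> nat) N : (forall x, S x -> w x <= N)%N ->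
  wqo_on S (fun x y => w x = w y).
Proof.
move=> wN; apply: wqo_sub (wqo_and (@wqo_nat S w) (@wqo_nat S
  (fun x => N - w x)%N)).
by move=> x y /wN ? /wN ? /= []; lia.
Qed.

End WellQuasiOrders.

(* Among the nonzero vectors of a submonoid of [T -> nat] closed under
   differences, an additive slope attains its maximum: a strictly increasing
   sequence of slopes, each term of minimal weight, would contain two comparable
   vectors, whose difference is shorter and steeper. *)
Lemma max_slope (T : finType) (Z : set (T -> nat)) (p1 p2 : (T -> nat) -> nat) :
  (forall x y, Z x -> Z y -> (forall i, x i <= y i)%N ->
     Z (fun i => y i - x i)%N) ->
  (forall x y, p1 (fun i => x i + y i)%N = p1 x + p1 y)%N ->
  (forall x y, p2 (fun i => x i + y i)%N = p2 x + p2 y)%N ->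
  (forall x, Z x -> p1 x = 0%N -> p2 x = 0%N) ->
  (exists x, Z x /\ 0 < p1 x)%N ->
  exists x, [/\ Z x, (0 < p1 x)%N &
    forall y, Z y -> (p2 y * p1 x <= p1 y * p2 x)%N].
Proof.
move=> ZB p1D p2D p12 [x0 [Zx0 x0gt]]; apply: contrapT => nomax.
pose S := [set x | Z x /\ (0 < p1 x)%N].
pose steeper x y := (p1 y * p2 x < p2 y * p1 x)%N.
pose wt (x : T -> nat) := (\sum_i x i)%N.
have steep x : exists y, S x -> [/\ S y, steeper x y &
    forall z, S z -> steeper x z -> (wt y <= wt z)%N].
  have [Sx|nSx] := pselect (S x); last by exists x.
  have ex : exists d, `[< exists y, [/\ S y, steeper x y & wt y = d] >].
    apply: contrapT => H; apply: nomax; exists x; split; [exact: Sx.1|exact: Sx.2|].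
    move=> y Zy; rewrite leqNgt; apply/negP => st; apply: H.
    exists (wt y); apply/asboolP; exists y; split=> //; split=> //.
    by case: (posnP (p1 y)) => // y0; move: st; rewrite (p12 y Zy y0).
  have := ex_minnP ex; case=> d /asboolP[y [Sy xy <-]] dmin.
  by exists y => _; split=> // z Sz xz; apply: dmin; apply/asboolP; exists z.
have [next nextP] := choice steep.
pose f n := iter n next x0.
have Sf n : S (f n) by elim: n => [|n IHn] //=; case: (nextP _ IHn).
have fS n : steeper (f n) (f n.+1) by case: (nextP _ (Sf n)).
have str x y z : S y -> steeper x y -> steeper y z -> steeper x z.
  rewrite /steeper => -[_ y0] xy yz.
  have [z0|z0] := posnP (p1 z); first by move: yz;
    rewrite z0 mul0n => /[!muln_gt0]/andP[p2z _]; nia.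
  rewrite -(ltn_pmul2r y0) -mulnA; nia.
have fm i j : (i < j)%N -> steeper (f i) (f j).
  elim: j => // j IHj; rewrite ltnS leq_eqVlt => /orP[/eqP->//|/IHj ij].
  exact: str (Sf j) ij (fS j).
have wq : wqo_on S (fun x y => forall i, i \in enum T -> (x i <= y i)%N).
  by apply: wqo_all => i _; exact: wqo_nat.
have [g [gm gle]] := wq f Sf.
have /gle le12 : (1 < 2)%N by [].
have /gm g12 : (1 < 2)%N by [].
have /gm : (0 < 1)%N by [].
move: (g 0%N) (g 1%N) (g 2%N) g12 le12 =>
  _ a b ab le12 /(leq_ltn_trans (leq0n _)) a0.
case: b ab le12 => // b; rewrite ltnS => ab le12.
have {}le12 i : (f a i <= f b.+1 i)%N by apply: le12; rewrite mem_enum.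
pose z i := (f b.+1 i - f a i)%N.
have fE : f b.+1 = fun i => (f a i + z i)%N by apply: funext => i; rewrite subnKC.
have Zz : Z z by apply: ZB => //; [exact: (Sf a).1 | exact: (Sf b.+1).1].
have e1 : (p1 (f b.+1) = p1 (f a) + p1 z)%N by rewrite fE p1D.
have e2 : (p2 (f b.+1) = p2 (f a) + p2 z)%N by rewrite fE p2D.
have stab : steeper (f a) (f b.+1) by apply: fm; rewrite ltnS.
have Sz : S z.
  split=> //; case: (posnP (p1 z)) => // z0; move: stab.
  by rewrite /steeper e1 e2 z0 (p12 _ Zz z0); lia.
have stz : steeper (f b) z.
  have az : steeper (f a) z by move: stab; rewrite /steeper e1 e2; nia.
  have bz : steeper (f b.+1) z by move: az; rewrite /steeper e1 e2; nia.
  exact: str (Sf b.+1) (fS b) bz.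
have [_ _ /(_ z Sz stz)] := nextP _ (Sf b).
have -> : wt (next (f b)) = (wt (f a) + wt z)%N.
  by rewrite -[next (f b)]/(f b.+1) fE /wt -big_split.
have : (0 < wt (f a))%N.
  rewrite lt0n /wt sum_nat_eq0; apply/negP => /forallP fa0.
  have fa : f a = (fun i => f a i + f a i)%N.
    by apply: funext => i; have /eqP-> := fa0 i.
  have := p1D (f a) (f a); rewrite -fa; have := (Sf a).2; lia.
lia.
Qed.

(** * Additive integer functions, submonoids and valuations *)

Section IntMorphisms.
Variables (G : comGroupType) (w : G -> int).
Hypothesis wM : forall x y, w (x * y) = (w x + w y)%R.

Lemma intmor1 : w 1 = 0%R.
Proof. by have := wM 1 1; rewrite mul1g; lia. Qed.

Lemma intmorV x : w x^-1 = (- w x)%R.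
Proof. by have := wM x x^-1; rewrite mulgV intmor1; lia. Qed.

Lemma intmorX x n : w (x ^+ n) = (n%:Z * w x)%R.
Proof.
elim: n => [|n IHn]; first by rewrite expg0 intmor1 GRing.mul0r.
by rewrite expgS wM IHn; lia.
Qed.

Lemma intmor_prod (I : Type) (r : seq I) (f : I -> G) :
  w (\prod_(i <- r) f i) = (\sum_(i <- r) w (f i))%R.
Proof.
by elim: r => [|i r IHr]; rewrite ?big_nil ?intmor1 // !big_cons wM IHr.
Qed.

End IntMorphisms.

Section Submonoids.
Variables (G : comGroupType) (D : set G).
Hypothesis Dm : submonoid D.

Lemma submonoid_prod (I : eqType) (r : seq I) (f : I -> G) :
  (forall i, i \in r -> D (f i)) -> D (\prod_(i <- r) f i).
Proof.
elim: r => [|i r IHr] Df; first by rewrite big_nil; exact: Dm.1.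
rewrite big_cons; apply: Dm.2; first by apply: Df; rewrite mem_head.
by apply: IHr => j jr; apply: Df; rewrite inE jr orbT.
Qed.

Lemma submonoidX x n : D x -> D (x ^+ n).
Proof.
move=> Dx; elim: n => [|n IHn]; first by rewrite expg0; exact: Dm.1.
by rewrite expgS; exact: Dm.2.
Qed.

Lemma units_submonoid : submonoid (units D).
Proof.
split; first by split; rewrite ?invg1; exact: Dm.1.
by move=> a b [Da Da'] [Db Db']; split; rewrite ?invgMC; apply: Dm.2.
Qed.

Lemma unitsV x : units D x -> units D x^-1.
Proof. by move=> [? ?]; split=> //; rewrite invgK. Qed.

Lemma unitsM_l x y : D x -> D y -> units D (x * y) -> units D x.
Proof.
move=> Dx Dy [_ Dxy]; split=> //.
have -> : x^-1 = (x * y)^-1 * y by abelg.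
exact: Dm.2.
Qed.

End Submonoids.

(* A finitely primary monoid of rank [s] and exponent [alpha], described by the
   valuations of its factorial overmonoid [F]; the [v i] with [i >= s] are
   irrelevant. *)
Record valued (G : comGroupType) (D : set G) (s alpha : nat)
    (v : nat -> G -> int) : Prop := Valued {
  valued_rank : (0 < s)%N;
  valued_mul : forall i x y, v i (x * y) = (v i x + v i y)%R;
  valued_ge0 : forall i x, (i < s)%N -> D x -> (0 <= v i x)%R;
  valued_unit : forall i x, (i < s)%N -> D x -> v i x = 0%R -> D x^-1;
  valued_conductor : forall x,
    (forall i, (i < s)%N -> (alpha%:Z <= v i x)%R) -> D x;
  valued_surj : forall k : nat -> int, exists x, forall i, (i < s)%N -> v i x = k i
}.

(** The exponents of the primes [q i] in [F] extend to fractions, that is, to all of [G]. The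
    inclusion of the nonunits of [D] in q_1...q_s F says that one vanishing exponent already forces
    a unit; the other inclusion gives the conductor condition. *)
Lemma finitely_primary_valued (G : comGroupType) (D : set G) :
  quotient_group D = setT -> finitely_primary D ->
  exists s alpha v, valued D s alpha v.
Proof.
move=> Dq [Dm [s [al [F [q [s0 [al0 [Fm [DF [qp [_ [Frep [Dsub Fsub]]]]]]]]]]]]].
have Um := units_submonoid Fm.
have FU x : units F x -> F x by case.
have Fq i : F (q i) by case: (qp i).
pose Q (k : {ffun 'I_s -> nat}) := \prod_(i < s) q i ^+ k i.
have FQ k : F (Q k) by apply: submonoid_prod => // i _; apply: submonoidX.
have QD (k l : {ffun 'I_s -> nat}) : Q [ffun i => k i + l i]%N = Q k * Q l.
  by rewrite -prodgMC; apply: eq_bigr => i _; rewrite ffunE expgnDr.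
have rep x : exists k, F x -> exists u, units F u /\ x = u * Q k.
  have [Fx|nFx] := pselect (F x); last by exists [ffun=> 0%N].
  by have [[u k] [[uF xE] _]] := Frep _ Fx; exists k => _; exists u.
have [kk kkP] := choice rep.
have Quniq u u' k k' : units F u -> units F u' -> u * Q k = u' * Q k' -> k = k'.
  move=> Uu Uu' E; have Fx : F (u * Q k) by apply: Fm.2 => //; exact: FU.
  have [uk [_ uniq]] := Frep _ Fx.
  have := uniq (u, k) (conj Uu erefl); rewrite (uniq (u', k') (conj Uu' E)).
  by case.
have kkE u k : units F u -> kk (u * Q k) = k.
  move=> Uu; have Fx : F (u * Q k) by apply: Fm.2 => //; exact: FU.
  by have [u' [Uu' E]] := kkP _ Fx; exact/esym/(Quniq _ _ _ _ Uu Uu' E).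
have kkQ k : kk (Q k) = k by rewrite -[Q k]mul1g kkE //; exact: Um.1.
have kkM x y i : F x -> F y -> kk (x * y) i = (kk x i + kk y i)%N.
  move=> /kkP[u [Uu Ex]] /kkP[u' [Uu' Ey]].
  have {1}-> : x * y = (u * u') * Q [ffun i => kk x i + kk y i]%N.
    by rewrite {1}Ex {1}Ey QD mulgACA.
  by rewrite kkE ?ffunE //; exact: Um.2.
have kk1 i : kk 1 i = 0%N.
  by apply: (@addnI (kk 1 i)); rewrite addn0 -kkM ?mul1g //; exact: Fm.1.
have frac x : exists ab : G * G, [/\ D ab.1, D ab.2 & x = ab.1 / ab.2].
  have : quotient_group D x by rewrite Dq.
  by move=> [a Da [b Db <-]]; exists (a, b).
have [fr frP] := choice frac.
(* Indexing by natural numbers, with value 0 beyond the rank, avoids types depending on [s], which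
   later varies with the prime. *)
pose v i x : int := if insub i is Some j
  then ((kk (fr x).1 j)%:Z - (kk (fr x).2 j)%:Z)%R else 0%R.
have vE (j : 'I_s) x : v j x = ((kk (fr x).1 j)%:Z - (kk (fr x).2 j)%:Z)%R.
  by rewrite /v valK.
have vfrac (j : 'I_s) a b : F a -> F b ->
    v j (a / b) = ((kk a j)%:Z - (kk b j)%:Z)%R.
  move=> Fa Fb; rewrite vE; have [/DF F1 /DF F2 E] := frP (a / b).
  have E' : (fr (a / b)).1 * b = a * (fr (a / b)).2.
    have -> : (fr (a / b)).1 = (fr (a / b)).1 / (fr (a / b)).2 * (fr (a / b)).2.
      by abelg.
    by rewrite -E; abelg.
  have := kkM _ _ j F1 Fb; rewrite E' kkM //; lia.
have Qv (k : {ffun 'I_s -> nat}) j : v (nat_of_ord j) (Q k) = ((k j)%:Z)%R.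
  rewrite -[Q k]mulg1 -invg1 vfrac ?kkQ //; last exact: Fm.1.
  by rewrite kk1; lia.
have vM (j : 'I_s) x y : v j (x * y) = (v j x + v j y)%R.
  have [/DF Fa /DF Fb Ex] := frP x; have [/DF Fc /DF Fd Ey] := frP y.
  have -> : x * y = ((fr x).1 * (fr y).1) / ((fr x).2 * (fr y).2).
    by rewrite {1}Ex {1}Ey; abelg.
  rewrite vfrac ?kkM //; try exact: Fm.2.
  by rewrite !vE; lia.
have vge0 (j : 'I_s) x : F x -> v j x = ((kk x j)%:Z)%R.
  move=> Fx; rewrite -[x in LHS]mulg1 -invg1 vfrac //; last exact: Fm.1.
  by rewrite kk1; lia.
pose q1 := \prod_(i < s) q i.
have q1X n : q1 ^+ n = Q [ffun=> n].
  elim: n => [|n IHn].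
    by rewrite expg0 /Q big1 // => i _; rewrite ffunE.
  rewrite expgS IHn -prodgMC; apply: eq_bigr => i _.
  by rewrite !ffunE expgS.
exists s, al, v; split=> //.
- move=> i x y; have [si|si] := boolP (i < s)%N; first exact: (vM (Ordinal si)).
  by rewrite /v insubF ?(negbTE si).
- by move=> i x si Dx; rewrite (vge0 (Ordinal si)) //; exact: DF.
- move=> i x si Dx; rewrite (vge0 (Ordinal si)) => [x0|]; last exact: DF.
  have [[]//|nU] := pselect (units D x).
  have [_ -> [f Ff E]] := Dsub x (conj Dx nU).
  have Fq1 : F q1 by apply: submonoid_prod => // j _.
  move: x0; rewrite -E kkM // -/q1 -[q1]expg1 q1X kkQ ffunE; lia.
(* Split [q1 ^+ al] off [x] inside [F]; the truncated subtractions are exact because of [xal]. *)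
- move=> x xal; apply: Fsub; have [/DF Fa /DF Fb Ex] := frP x.
  have [u [Uu Ea]] := kkP _ Fa; have [u' [Uu' Eb]] := kkP _ Fb.
  exists (q1 ^+ al) => //.
  exists ((u / u') * Q [ffun i => kk (fr x).1 i - kk (fr x).2 i - al]%N).
    by apply: Fm.2 => //; apply: FU; apply: Um.2 => //; exact: unitsV.
  have Ex' : x = (u * Q (kk (fr x).1)) / (u' * Q (kk (fr x).2)) by rewrite -Ea -Eb.
  rewrite q1X mulgCA -QD [RHS]Ex'.
  have -> : Q (kk (fr x).1) = Q [ffun i => (kk (fr x).1 i - kk (fr x).2 i)]%N
     * Q (kk (fr x).2).
    rewrite -QD; congr Q; apply/ffunP => i; rewrite !ffunE subnK //.
    by have := xal i (ltn_ord i); rewrite vE; lia.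
  set A := Q [ffun i => _ + _]%N; set B := Q [ffun i => _]%N.
  have -> : A = B.
    congr Q; apply/ffunP => i; rewrite !ffunE.
    by have := xal i (ltn_ord i); rewrite vE; lia.
  by abelg.
- move=> k; pose kp : {ffun 'I_s -> nat} :=
    [ffun i : 'I_s => if (0 <= k i)%R then `|k i|%N else 0%N].
  pose kn : {ffun 'I_s -> nat} :=
    [ffun i : 'I_s => if (0 <= k i)%R then 0%N else `|k i|%N].
  exists (Q kp / Q kn) => i si; rewrite (vfrac (Ordinal si)) // !kkQ !ffunE /=.
  by case: ifP; lia.
Qed.

(** * Sets of lengths and factorizations *)

Section SetsOfLengths.

Lemma set_maxE (L : set nat) M : L M ->
  (forall k, L k -> (k <= M)%N) -> set_max L = M.
Proof.
move=> LM Mmax; rewrite /set_max; case: xgetP => [m _ [Lm mmax]|/(_ M)[]//].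
by apply/eqP; rewrite eqn_leq Mmax ?mmax.
Qed.

Lemma set_minE (L : set nat) m : L m ->
  (forall k, L k -> (m <= k)%N) -> set_min L = m.
Proof.
move=> Lm mmin; rewrite /set_min; case: xgetP => [k _ [Lk kmin]|/(_ m)[]//].
by apply/eqP; rewrite eqn_leq mmin ?kmin.
Qed.

Lemma elasticity_of_setE (L : set nat) M m : L M -> L m -> (0 < m)%N ->
  (forall k, L k -> (m <= k <= M)%N) ->
  elasticity_of_set L = (M%:R / m%:R)%R.
Proof.
move=> LM Lm m0 Lk; rewrite /elasticity_of_set.
case: asboolP => [L0|_]; first by move: Lm m0; rewrite L0 => ->.
rewrite (@set_maxE _ M) ?(@set_minE _ m) // => k /Lk /andP[] //.
Qed.

End SetsOfLengths.

Section Factorizations.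
Variables (G : comGroupType) (H : set G).
Hypothesis Hm : submonoid H.
Implicit Types (a b e h t x y : G) (r : seq G).

Let Um := units_submonoid Hm.

Lemma units_sub e : units H e -> H e. Proof. by case. Qed.

Lemma atom_sub x : atom H x -> H x. Proof. by case. Qed.

Lemma atom_unitM e x : units H e -> atom H x -> atom H (e * x).
Proof.
move=> Ue [Hx nUx xE]; split; first exact: Hm.2 (units_sub Ue) Hx.
- by move=> Uex; apply: nUx; rewrite -(mulKg e x); apply: Um.2 => //; exact: unitsV.
- move=> a b Ha Hb E; have Ue' := unitsV Ue.
  have Hea : H (e^-1 * a) by apply: Hm.2 => //; case: Ue'.
  have xE' : x = (e^-1 * a) * b by rewrite -mulgA -E mulKg.
  have [Ua|Ub] := xE _ b Hea Hb xE'; [left|by right].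
  by rewrite -(mulVKg e a); exact: Um.2.
Qed.

Lemma prod_atoms_sub r : (forall x, x \in r -> atom H x) -> H (\prod_(x <- r) x).
Proof. by move=> rA; apply: submonoid_prod => // x /rA /atom_sub. Qed.

(** The unit [e] lets the empty list represent the units, which removes the case distinction from
    [lengths]; for a nonempty list it is absorbed into the first atom. *)
Definition factors h e r :=
  [/\ units H e, forall x, x \in r -> atom H x & h = e * \prod_(x <- r) x].

Lemma lengthsP h k : lengths H h k <->
  exists e r, factors h e r /\ size r = k.
Proof.
split=> [[[Uh ->]|[nUh k0 [u [uA ->]]]]|[e [r [[Ue rA ->] <-]]]].
- by exists h, [::]; split=> //; split=> //; rewrite big_nil mulg1.
- exists 1, [seq u i | i <- enum 'I_k]; split;
  last by rewrite size_map size_enum_ord.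
  split; first exact: Um.1.
    by move=> x /mapP[i _ ->].
  by rewrite mul1g big_map big_enum.
- case: r rA => [|x r] rA; first by left; rewrite big_nil mulg1.
  have xA : atom H x by apply: rA; rewrite mem_head.
  have rA' y : y \in r -> atom H y by move=> yr; apply: rA; rewrite inE yr orbT.
  right; split=> //.
    rewrite big_cons mulgCA => U; have [Hx nU _] := xA; apply: nU.
    apply: unitsM_l U => //; apply: Hm.2;
      [exact: units_sub | exact: prod_atoms_sub].
  exists (fun i : 'I_(size r).+1 => nth 1 (e * x :: r) i); split.
    case=> [[|i]] /= ir; first exact: atom_unitM.
    by apply: rA'; exact: mem_nth.
  rewrite -(big_mkord xpredT (nth 1 (e * x :: r))).
  by rewrite -(big_nth 1 xpredT (fun y => y) (r := e * x :: r)) !big_cons mulgA.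
Qed.

Lemma lengths_unit h : lengths H h 0%N <-> units H h.
Proof. by split=> [[[]|[]]|U] //; left. Qed.

Lemma lengths_of_unit h k : units H h -> lengths H h k -> k = 0%N.
Proof. by move=> U [[]|[]]. Qed.

Lemma lengths1 h : lengths H h 1%N <-> atom H h.
Proof.
split=> [[[]|[_ _ [u [uA ->]]]]//|hA]; first by rewrite big_ord1.
apply/lengthsP; exists 1, [:: h]; split=> //; split; first exact: Um.1.
- by move=> x; rewrite inE => /eqP->.
- by rewrite big_seq1 mul1g.
Qed.

Lemma lengthsM a b k l : lengths H a k -> lengths H b l ->
  lengths H (a * b) (k + l).
Proof.
move=> /lengthsP[e [r [[Ue rA ->] <-]]] /lengthsP[e' [r' [[Ue' rA' ->] <-]]].
apply/lengthsP; exists (e * e'), (r ++ r'); rewrite size_cat; split=> //; split.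
- exact: Um.2.
- by move=> x; rewrite mem_cat => /orP[/rA|/rA'].
- by rewrite big_cat /= mulgACA.
Qed.

Lemma prime_elt_atom x : prime_elt H x -> atom H x.
Proof.
move=> [Hx nU xp]; split=> // a b Ha Hb E.
have dvd c d : H c -> H d -> x = c * d -> divides H x c -> units H d.
  move=> Hc Hd Ex [q [Hq cE]]; split=> //.
  have qd : q * d = 1 by apply: (mulgI x); rewrite mulgA -cE -Ex mulg1.
  by rewrite -(mul1g d^-1) -qd mulgK.
have dvdab : divides H x (a * b) by exists 1; rewrite mulg1; split=> //;
  exact: Hm.1.
have [xa|xb] := xp a b Ha Hb dvdab.
  by right; exact: dvd Ha Hb E xa.
by left; apply: dvd Hb Ha _ xb; rewrite mulgC.
Qed.

(** A prime element divides some atom of every factorization of [x * h], so that atom is associated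
    with [x] and can be cancelled. Multiplying by a prime thus shifts the whole set of lengths by
    one. *)
Lemma prime_elt_lengths x h k : prime_elt H x -> H h ->
  lengths H (x * h) k -> (0 < k)%N /\ lengths H h k.-1.
Proof.
move=> xP Hh /lengthsP[e [r [[Ue rA E] <-]]]; have [Hx nU xp] := xP.
have : divides H x (e * \prod_(y <- r) y) by rewrite -E; exists h.
move=> /(xp _ _ (units_sub Ue) (prod_atoms_sub rA))[[c [Hc eE]]|].
  by case: nU; apply: unitsM_l Hc _ => //; rewrite -eE.
move=> dvd; have {dvd} : exists2 y, y \in r & divides H x y.
  elim: r rA dvd {E} => [|y r IHr] rA.
    rewrite big_nil => -[c [Hc E]]; case: nU; split=> //.
    by rewrite -[x^-1]mulg1 E mulKg.
  have yA : atom H y by apply: rA; rewrite mem_head.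
  have rA' t : t \in r -> atom H t by move=> tr; apply: rA; rewrite inE tr orbT.
  rewrite big_cons => /(xp _ _ (atom_sub yA) (prod_atoms_sub rA'))[|/(IHr rA')[t
    tr ?]].
    by exists y; rewrite ?mem_head.
  by exists t; rewrite // inE tr orbT.
move=> [y yr [c [Hc yE]]]; have [Hy _ yI] := rA y yr.
have Uc : units H c by case: (yI x c Hx Hc yE).
have size_r := size_rem yr; split; first by case: (r) yr.
apply/lengthsP; exists (e * c), (rem y r); split=> //; split; first exact: Um.2.
- by move=> t /mem_rem /rA.
- apply: (mulgI x); rewrite E (big_rem y) //= {1}yE; abelg.
Qed.

Lemma prime_elt_lengthsX x h j k : prime_elt H x -> H h ->
  lengths H (x ^+ j * h) k -> (j <= k)%N /\ lengths H h (k - j).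
Proof.
move=> xP Hh; have Hx : H x by case: xP.
elim: j k => [|j IHj] k; first by rewrite expg0 mul1g subn0.
rewrite expgS -mulgA => /prime_elt_lengths[] //.
  by apply: Hm.2 => //; exact: submonoidX.
by move=> k0 /IHj[jk]; case: k k0 jk => // k _ jk; rewrite subSS.
Qed.

Lemma prime_elt_lengthsX_mem x h j k : prime_elt H x ->
  lengths H h k -> lengths H (x ^+ j * h) (j + k).
Proof.
move=> xP Lk; elim: j => [|j IHj]; first by rewrite expg0 mul1g.
rewrite expgS -mulgA addSn -add1n; apply: lengthsM => //.
by apply/lengths1; exact: prime_elt_atom.
Qed.

(** The function may depend on [h]: only nonunit divisors of [h] must get positive values. Its value
    at [h] bounds the number of factors, and induction on it produces factorizations. *)
Hypothesis length_fun : forall h, H h -> exists w : G -> int,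
  [/\ forall x y, w (x * y) = (w x + w y)%R, forall x, H x -> (0 <= w x)%R &
    forall x y, H x -> H y -> h = x * y -> ~ units H x -> (0 < w x)%R].

Lemma lengths_nonempty h : H h -> exists k, lengths H h k.
Proof.
move=> Hh; have [w [wM w0 wpos]] := length_fun Hh.
suff : forall n x y, H x -> H y -> h = x * y -> (w x <= n%:Z)%R ->
  exists k, lengths H x k.
  move=> /(_ `|w h|%N h 1) []; rewrite ?mulg1 //; [exact: Hm.1 | lia |].
  by move=> k Lk; exists k.
elim=> [|n IHn] x y Hx Hy E wx.
  exists 0%N; apply/lengths_unit; apply: contrapT => nU.
  by have := wpos x y Hx Hy E nU; lia.
have [Ux|nUx] := pselect (units H x); first by exists 0%N; apply/lengths_unit.
have [xA|nA] := pselect (atom H x); first by exists 1%N; apply/lengths1.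
have [a [b [Ha Hb xE nUa nUb]]] : exists a b, [/\ H a, H b, x = a * b,
  ~ units H a & ~ units H b].
  apply: contrapT => no; apply: nA; split=> // a b Ha Hb xE.
  by apply: contrapT => /not_orP[nUa nUb]; apply: no; exists a, b.
have Ea : h = a * (b * y) by rewrite E xE mulgA.
have Eb : h = b * (a * y) by rewrite E xE; abelg.
have wa := wpos a _ Ha (Hm.2 _ _ Hb Hy) Ea nUa.
have wb := wpos b _ Hb (Hm.2 _ _ Ha Hy) Eb nUb.
move: wx; rewrite xE wM => wx.
have [||k Lk] := IHn a _ Ha _ Ea; [exact: Hm.2 | lia |].
have [||l Ll] := IHn b _ Hb _ Eb; [exact: Hm.2 | lia |].
by exists (k + l)%N; exact: lengthsM.
Qed.

Lemma lengths_bounded h : H h -> exists n, forall k, lengths H h k -> (k <= n)%N.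
Proof.
move=> Hh; have [w [wM w0 wpos]] := length_fun Hh.
exists `|w h|%N => k /lengthsP[e [r [[Ue rA E] <-]]].
have : ((size r)%:Z <= w (\prod_(x <- r) x)%g)%R.
  rewrite intmor_prod //.
  have : forall x, x \in r -> (1 <= w x)%R.
    move=> x xr; have [Hx nU _] := rA x xr.
    suff : (0 < w x)%R by lia.
    apply: (wpos x (e * \prod_(y <- rem x r) y) Hx) => //.
      apply: Hm.2; first exact: units_sub.
      by apply: prod_atoms_sub => y /mem_rem /rA.
    by rewrite E (big_rem x) //= mulgCA.
  elim: (r) => [|x r' IHr] wr; first by rewrite big_nil.
  have wr' y : y \in r' -> (1 <= w y)%R by move=> yr; apply: wr;
    rewrite inE yr orbT.
  have w1 := wr x (mem_head _ _); move: (IHr wr'); rewrite big_cons /=.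
  by set S := (\sum_(y <- r') _)%R; lia.
have := w0 _ (units_sub Ue); rewrite E wM; set S := w (\prod_(x <- r) x); lia.
Qed.

Lemma lengths_minmax h : H h -> exists m M, [/\ lengths H h m, lengths H h M &
  forall k, lengths H h k -> (m <= k <= M)%N].
Proof.
move=> Hh; have [k0 Lk0] := lengths_nonempty Hh.
have [n nP] := lengths_bounded Hh.
have exk : exists k, `[< lengths H h k >] by exists k0; apply/asboolP.
have bnd k : `[< lengths H h k >] -> (k <= n)%N by move=> /asboolP /nP.
have := ex_minnP exk; case=> m /asboolP Lm mP.
have := ex_maxnP exk bnd; case=> M /asboolP LM MP.
by exists m, M; split=> // k /asboolP Lk; rewrite mP ?MP.
Qed.

End Factorizations.

(** * Realizing a prescribed ratio of lengths *)

Section ElasticityInterpolation.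
Variables (G : comGroupType) (H : set G).
Hypothesis Hm : submonoid H.
Hypothesis length_fun : forall h, H h -> exists w : G -> int,
  [/\ forall x y, w (x * y) = (w x + w y)%R, forall x, H x -> (0 <= w x)%R &
    forall x y, H x -> H y -> h = x * y -> ~ units H x -> (0 < w x)%R].
Variables (a A : G) (N : nat) (u : 'I_N -> G).
Hypotheses (Ha : H a) (HA : atom H A).
Hypothesis lengths_A : forall n k, lengths H (A ^+ n) k -> k = n.
Hypothesis atoms_u : forall i, atom H (u i).
(** Every [a ^+ m * A ^+ n] divides a power of [a * A], so the atoms [u] suffice, up to units, for
    all factorizations below. *)
Hypothesis atoms_fin : forall t n c, atom H t -> H c -> (a * A) ^+ n = t * c ->
  exists i e, units H e /\ t = e * u i.

Let Um := units_submonoid Hm.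

Definition pow_prod (f : 'I_N -> nat) : G := \prod_(i < N) u i ^+ f i.
Definition weight (f : 'I_N -> nat) : nat := (\sum_(i < N) f i)%N.

Lemma pow_prodD f g : pow_prod (fun i => f i + g i)%N = pow_prod f * pow_prod g.
Proof. by rewrite -prodgMC; apply: eq_bigr => i _; rewrite expgnDr. Qed.

Lemma pow_prodM n f : pow_prod (fun i => n * f i)%N = pow_prod f ^+ n.
Proof.
elim: n => [|n IHn]; first by rewrite /pow_prod big1 // => i _; rewrite mul0n.
by rewrite expgS -IHn -pow_prodD; apply: eq_bigr => i _; rewrite mulSn.
Qed.

Lemma weightD f g : weight (fun i => f i + g i)%N = (weight f + weight g)%N.
Proof. by rewrite /weight big_split. Qed.

Lemma weightM n f : weight (fun i => n * f i)%N = (n * weight f)%N.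
Proof. by rewrite /weight -big_distrr. Qed.

Lemma pow_prod_lengths f : lengths H (pow_prod f) (weight f).
Proof.
rewrite /pow_prod /weight; elim/big_rec2: _ => [|i k h _ Lk].
  by apply/lengths_unit; exact: Um.1.
apply: lengthsM => //; elim: (f i) => [|n IHn].
  by apply/lengths_unit; rewrite expg0; exact: Um.1.
by rewrite expgS -add1n; apply: lengthsM => //; apply/lengths1.
Qed.

Lemma lengths_of_pow_prod h f : units H (h / pow_prod f) -> lengths H h (weight f).
Proof.
move=> U; rewrite -[h](mulgVK (pow_prod f)) -[weight f]add0n.
by apply: lengthsM => //; [apply/lengths_unit | exact: pow_prod_lengths].
Qed.

Lemma pow_prod_of_lengths h k n c : H c -> (a * A) ^+ n = h * c -> lengths H h k ->
  exists f, weight f = k /\ units H (h / pow_prod f).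
Proof.
move=> Hc E /(lengthsP Hm)[e [r [[Ue rA hE] <-]]].
have Hec : H (e * c) by apply: Hm.2 => //; case: Ue.
have {}E : (a * A) ^+ n = (\prod_(x <- r) x) * (e * c) by rewrite E hE; abelg.
have [f [wf Uf]] :
  exists f, weight f = size r /\ units H ((\prod_(x <- r) x) / pow_prod f).
  elim: r (e * c) Hec rA E {hE} => [|x r IHr] d Hd rA E.
    exists (fun=> 0%N); split; first by rewrite /weight big1.
    by rewrite big_nil /pow_prod big1 // mulgV; exact: Um.1.
  have xA : atom H x by apply: rA; rewrite mem_head.
  have rA' y : y \in r -> atom H y by move=> yr; apply: rA; rewrite inE yr orbT.
  have Hxd : H (x * d) by apply: Hm.2 => //; case: xA.
  have Exd : (a * A) ^+ n = (\prod_(y <- r) y) * (x * d) by rewrite E big_cons;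
    abelg.
  have [f [wf Uf]] := IHr _ Hxd rA' Exd.
  have Hrd : H ((\prod_(y <- r) y) * d) by apply: Hm.2 => //; exact: prod_atoms_sub.
  have [|i [e' [Ue' xE]]] := atoms_fin xA Hrd (n := n).
    by rewrite E big_cons mulgA.
  exists (fun j => (j == i) + f j)%N; split.
    rewrite weightD wf /weight (bigD1 i) //= eqxx big1 //.
    by move=> j /negPf->.
  rewrite pow_prodD big_cons {1}xE.
  have -> : pow_prod (fun j => j == i) = u i.
    rewrite /pow_prod (bigD1_seq i) ?index_enum_uniq ?mem_index_enum //= eqxx.
    by rewrite big1 ?mulg1 // => j /negPf->.
  set q := \prod_(y <- r) y.
  have -> : e' * u i * q / (u i * pow_prod f) = e' * (q / pow_prod f) by abelg.
  exact: Um.2.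
exists f; split=> //; rewrite hE -mulgA; exact: Um.2.
Qed.

Variables (x y : nat).
Hypotheses (y0 : (0 < y)%N) (yx : (y < x)%N).

Lemma elasticity_interpolation k l :
  lengths H a k -> lengths H a l -> (x * l < y * k)%N ->
  exists b m M, [/\ H b, lengths H b m, lengths H b M, (0 < m)%N &
    (y * M = x * m)%N /\ forall j, lengths H b j -> (m <= j <= M)%N].
Proof.
move=> Lk Ll kl; have HA' := atom_sub HA.
pose T := (bool + ('I_N + 'I_N))%type.
pose e1 (z : T -> nat) := z (inl true); pose e2 (z : T -> nat) := z (inl false).
pose z1 (z : T -> nat) i := z (inr (inl i));
  pose z2 (z : T -> nat) i := z (inr (inr i)).
pose base z := a ^+ e1 z * A ^+ e2 z.
pose Z z := [/\ units H (base z / pow_prod (z1 z)),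
  units H (base z / pow_prod (z2 z)) &
  (y * weight (z1 z) = x * weight (z2 z))%N].
have Hbase n m : H (a ^+ n * A ^+ m) by apply: Hm.2; exact: submonoidX.
have base_dvd n m : (a * A) ^+ (n + m) = (a ^+ n * A ^+ m) * (a ^+ m * A ^+ n).
  by rewrite expgMC !expgnDr; abelg.
have fac n m j : lengths H (a ^+ n * A ^+ m) j ->
    exists f, weight f = j /\ units H (a ^+ n * A ^+ m / pow_prod f).
  by apply: (pow_prod_of_lengths (n := (n + m)%N) (c := a ^+ m * A ^+ n)).
have [fk [wk Uk]] : exists f, weight f = k /\ units H (a / pow_prod f).
  by have := fac 1%N 0%N k; rewrite expg1 expg0 mulg1; apply.
have [fl [wl Ul]] : exists f, weight f = l /\ units H (a / pow_prod f).
  by have := fac 1%N 0%N l; rewrite expg1 expg0 mulg1; apply.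
have [fA [wA UA]] : exists f, weight f = 1%N /\ units H (A / pow_prod f).
  by have := fac 0%N 1%N 1%N; rewrite expg1 expg0 mul1g; apply; apply/lengths1.
have unitX h n : units H h -> units H (h ^+ n) by exact: submonoidX.
(* the vector obtained from factorizations [f], [g] of [a^n A^m] by passing to
   [(a^n A^m)^(x-y) A^w] *)
pose mix n m w (f g : 'I_N -> nat) : T -> nat := fun t => match t with
  | inl true => ((x - y) * n)%N
  | inl false => ((x - y) * m + w)%N
  | inr (inl i) => ((x - y) * f i + w * fA i)%N
  | inr (inr i) => ((x - y) * g i + w * fA i)%N
  end.
(* The number of added copies of [A] is the solution w of y((x-y)M + w) = x((x-y)m + w), where M and
   m are the weights of [f] and [g]; the factor x - y makes it an integer. *)
have mixZ n m f g : units H (a ^+ n * A ^+ m / pow_prod f) ->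
    units H (a ^+ n * A ^+ m / pow_prod g) -> (x * weight g <= y * weight f)%N ->
    Z (mix n m (y * weight f - x * weight g)%N f g).
  move=> Uf Ug le; set w := (_ - _)%N.
  have fact (h : 'I_N -> nat) : units H (a ^+ n * A ^+ m / pow_prod h) ->
      units H (base (mix n m w f g) / pow_prod
        (fun i => (x - y) * h i + w * fA i)%N).
    move=> Uh; rewrite /base /e1 /e2 /= pow_prodD !pow_prodM.
    rewrite (mulnC (x - y)%N n) (mulnC (x - y)%N m) expgnDr !expgnA.
    have := Um.2 _ _ (unitX _ (x - y)%N Uh) (unitX _ w UA).
    rewrite !expgMC !expVgn.
    congr (units H); abelg.
  split; [exact: fact | exact: fact |].
  rewrite /z1 /z2 /= !weightD !weightM wA !muln1.
  rewrite /w; move: le yx; nia.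
have [z [Zz pz zmax]] : exists z, [/\ Z z, (0 < e1 z)%N &
    forall z', Z z' -> (e2 z' * e1 z <= e1 z' * e2 z)%N].
  apply: max_slope => //.
  - move=> z z' [U1 U2 E] [U1' U2' E'] zz'.
    have baseE : base z' = base (fun t => z' t - z t)%N * base z.
      rewrite /base /e1 /e2 /= mulgACA -!expgnDr !subnK //.
    have prodE (j : 'I_N -> T) : pow_prod (fun i => z' (j i)) =
        pow_prod (fun i => z' (j i) - z (j i))%N * pow_prod (fun i => z (j i)).
      by rewrite -pow_prodD; apply: eq_bigr => i _; rewrite subnK.
    have wE (j : 'I_N -> T) : weight (fun i => z' (j i)) =
        (weight (fun i => z' (j i) - z (j i)) + weight (fun i => z (j i)))%N.
      by rewrite -weightD; apply: eq_bigr => i _; rewrite subnK.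
    have quot (j : 'I_N -> T) : units H (base z' / pow_prod (fun i => z' (j i))) ->
        units H (base z / pow_prod (fun i => z (j i))) ->
        units H (base (fun t => z' t - z t)%N / pow_prod
          (fun i => z' (j i) - z (j i))%N).
      move=> U' U; have := Um.2 _ _ U' (unitsV U).
      by rewrite baseE prodE; congr (units H); abelg.
    split; [exact: quot | exact: quot |].
    by move: E E'; rewrite /z1 /z2 !wE; nia.
  (* Without [a] the element is a unit times nothing but a power of [A], so both weights equal its
     exponent, and y < x forces that exponent to be 0. *)
  - move=> z [U1 U2 E] z0.
    have b0 : base z = A ^+ e2 z by rewrite /base z0 expg0 mul1g.
    move: U1 U2; rewrite b0 =>
      /lengths_of_pow_prod/lengths_A E1 /lengths_of_pow_prod/lengths_A E2.
    by move: E; rewrite E1 E2; move: yx; nia.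
  - exists (mix 1%N 0%N (y * weight fk - x * weight fl)%N fk fl); split.
      by apply: mixZ; rewrite ?expg1 ?expg0 ?mulg1 // wk wl ltnW.
    by rewrite /e1 /= muln1 subn_gt0.
have Hb : H (base z) by exact: Hbase.
have [m [M [Lm LM mM]]] := lengths_minmax Hm length_fun Hb.
exists (base z), m, M; split=> //.
  rewrite lt0n; apply/eqP => m0; move: Lm; rewrite m0 => /lengths_unit U.
  have Ua : units H a.
    have Haz : H (a ^+ (e1 z).-1 * A ^+ e2 z) by exact: Hbase.
    apply: (unitsM_l Hm Ha Haz).
    by rewrite mulgA -expgS prednK.
  by move: kl; rewrite (lengths_of_unit Ua Lk) (lengths_of_unit Ua Ll); lia.
split=> //.
have [f [wf Uf]] := fac _ _ _ LM; have [g [wg Ug]] := fac _ _ _ Lm.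
have [/lengths_of_pow_prod/mM le1 /lengths_of_pow_prod/mM le2 E] := Zz.
have le : (x * m <= y * M)%N by move: le1 le2 E; nia.
(* If M/m exceeded x/y, [mix] applied to the extremal factorizations would add a positive number of
   copies of [A] to the (x-y)-th power of [base z], giving a steeper vector. *)
apply/eqP; rewrite eqn_leq le andbT leqNgt; apply/negP => lt.
have := zmax _ (mixZ _ _ f g Uf Ug _); rewrite wf wg => /(_ le).
move: lt pz yx; rewrite /e1 /e2 /= -(subn_gt0 (x * m)).
set w := (y * M - x * m)%N; set e := z (inl true); set e' := z (inl false).
nia.
Qed.

End ElasticityInterpolation.

Lemma ltn_count (T : eqType) (P Q : pred T) (r : seq T) x :
  (forall y, y \in r -> P y -> Q y) -> x \in r -> Q x -> ~~ P x ->
  (count P r < count Q r)%N.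
Proof.
have le (r' : seq T) :
  (forall y, y \in r' -> P y -> Q y) -> (count P r' <= count Q r')%N.
  elim: r' => //= a r' IHr' PQ; apply: leq_add.
    by have := PQ a (mem_head _ _); case: (P a) => // ->.
  by apply: IHr' => y yr; apply: PQ; rewrite inE yr orbT.
move=> PQ xr Qx nPx; have /permP E := perm_to_rem xr.
rewrite !E /= Qx (negPf nPx) add0n add1n ltnS; apply: le => y /mem_rem; exact: PQ.
Qed.

(** A minimum of f/g in cross-multiplied form: entries with g = 0 count as infinite, which is
    consistent because f is nonnegative. *)
Lemma min_ratio (T : eqType) (r : seq T) (f g : T -> int) (x0 : T) :
  (forall x, x \in r -> (0 <= f x)%R /\ (0 <= g x)%R) ->
  x0 \in r -> (0 < g x0)%R ->
  exists2 x, x \in r & (0 < g x)%R /\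
    forall y, y \in r -> (f x * g y <= f y * g x)%R.
Proof.
elim: r x0 => // a r IHr x0 nonneg x0r x0g.
have nonneg' y : y \in r -> (0 <= f y)%R /\ (0 <= g y)%R.
  by move=> yr; apply: nonneg; rewrite inE yr orbT.
have [fa ga] := nonneg a (mem_head _ _).
have aP : (0 < g a)%R -> (forall y, y \in r -> (f a * g y <= f y * g a)%R) ->
    exists2 x, x \in a :: r & (0 < g x)%R /\
      forall y, y \in a :: r -> (f x * g y <= f y * g x)%R.
  move=> ga0 H; exists a; rewrite ?mem_head //; split=> // y.
  by rewrite inE => /orP[/eqP->|/H].
have [[x1 [x1r x1g]]|no] := pselect (exists x, x \in r /\ (0 < g x)%R).
  have [x xr [xg xmin]] := IHr x1 nonneg' x1r x1g.
  have [fx gx] := nonneg' x xr.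
  have [le|lt] := boolP (f x * g a <= f a * g x)%R.
    exists x; rewrite ?inE ?xr ?orbT //; split=> // y.
    by rewrite inE => /orP[/eqP->|/xmin].
  apply: aP => [|y yr]; first by nia.
  have := xmin y yr; have [fy gy] := nonneg' y yr; nia.
have r0 y : y \in r -> g y = 0%R.
  move=> yr; have [_ gy] := nonneg' y yr.
  have : ~ (0 < g y)%R by move=> ?; apply: no; exists y.
  lia.
move: x0r; rewrite inE => /orP[/eqP E|/r0 E]; last by move: x0g; rewrite E.
subst x0; apply: aP => // y yr; rewrite (r0 y yr) GRing.mulr0.
by have [fy _] := nonneg' y yr; nia.
Qed.

(** * Prime ideals and localizations *)

Section PrimeIdeals.
Variables (G : comGroupType) (H : set G).
Hypothesis Hm : submonoid H.
Implicit Types (p : set G) (x y : G).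

Lemma s_idealM p x y : s_ideal H p -> p x -> H y -> p (x * y).
Proof. by move=> [_ <-] [a pa [b Hb <-]] Hy; exists a => //; exists (b * y);
  rewrite ?mulgA //; exact: Hm.2. Qed.

Lemma prime_notin1 p : prime_s_ideal H p -> ~ p 1.
Proof. by move=> [_ [[]]]. Qed.

Lemma primeM p x y : prime_s_ideal H p -> H x -> H y -> p (x * y) -> p x \/ p y.
Proof.
move=> [_ [_ pM]] Hx Hy pxy; apply: contrapT => /not_orP[nx ny].
by have [_] := pM x y (conj Hx nx) (conj Hy ny).
Qed.

Lemma prime_prod_notin p (I : eqType) (r : seq I) (f : I -> G) :
  prime_s_ideal H p -> (forall i, i \in r -> H (f i) /\ ~ p (f i)) ->
  H (\prod_(i <- r) f i) /\ ~ p (\prod_(i <- r) f i).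
Proof. by move=> pp Hf; exact: (submonoid_prod (D := H `\` p) pp.2). Qed.

Lemma primeX_notin p x n : prime_s_ideal H p -> H x -> ~ p x -> ~ p (x ^+ n).
Proof. by move=> pp Hx npx;
  case: (submonoidX (D := H `\` p) pp.2 n (conj Hx npx)). Qed.

Lemma loc_sub p : prime_s_ideal H p -> H `<=` localization H p.
Proof.
move=> pp x Hx; exists x => //; exists 1; last by rewrite invg1 mulg1.
by split; [exact: Hm.1 | exact: prime_notin1].
Qed.

Lemma loc_submonoid p : prime_s_ideal H p -> submonoid (localization H p).
Proof.
move=> pp; split; first by apply: loc_sub => //; exact: Hm.1.
move=> _ _ [a Ha [s Hs <-]] [b Hb [t Ht <-]].
exists (a * b); first exact: Hm.2.
by exists (s * t); [exact: pp.2.2 | abelg].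
Qed.

Lemma loc_inv p x : prime_s_ideal H p -> H x -> ~ p x -> localization H p x^-1.
Proof. by move=> pp Hx npx; exists 1; [exact: Hm.1 | exists x; rewrite ?mul1g]. Qed.

Lemma loc_unit p x : prime_s_ideal H p -> H x -> ~ p x ->
  units (localization H p) x.
Proof. by move=> pp Hx npx; split; [exact: loc_sub | exact: loc_inv]. Qed.

Lemma loc_nonunit p x : prime_s_ideal H p -> p x -> ~ localization H p x^-1.
Proof.
move=> pp px [a Ha [s [Hs nps] E]]; apply: nps.
have -> : s = x * a by rewrite -[x]invgK -E; abelg.
exact: s_idealM pp.1 _ _.
Qed.

End PrimeIdeals.

Lemma quotient_group_sub (G : comGroupType) (H D : set G) :
  H `<=` D -> quotient_group H = setT -> quotient_group D = setT.
Proof.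
move=> HD Hq; apply/seteqP; split=> // x _.
have : quotient_group H x by rewrite Hq.
by move=> [a Ha [b Hb <-]]; exists a; [exact: HD | exists b => //; exact: HD].
Qed.

(** * Valuations and approximation in weakly Krull monoids *)

Section WeaklyKrull.
Variables (G : comGroupType) (H : set G).
Hypotheses (Hm : submonoid H) (Hq : quotient_group H = setT).
Hypothesis HwK : weakly_Krull H.
Implicit Types (p : set G) (x y : G).
Local Notation X := (min_primes H).
Local Notation loc := (localization H).

Lemma min_prime_prime p : X p -> prime_s_ideal H p.
Proof. by case. Qed.
Local Notation mpp := min_prime_prime.

Lemma min_prime_sub p : X p -> p `<=` H.
Proof. by move=> [[[]]]. Qed.

Lemma mem_of_loc x : (forall p, X p -> loc p x) -> H x.
Proof. by move=> Hx; rewrite HwK.1 => p; exact: Hx. Qed.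

Lemma min_prime_sep p p' : X p -> X p' -> p' <> p -> exists t, p' t /\ ~ p t.
Proof.
move=> [pp [a pa] pmin] [pp' p'0 _] np; apply: contrapT => nt; apply: np.
by apply: pmin => // t p't; apply: contrapT => npt; apply: nt; exists t.
Qed.

Lemma quotient_frac x : exists a b, [/\ H a, H b & x = a / b].
Proof.
have : quotient_group H x by rewrite Hq.
by move=> [a Ha [b Hb <-]]; exists a, b.
Qed.

Lemma loc_nonunit_finite x : finite_set [set p | X p /\ ~ units (loc p) x].
Proof.
have [a [b [Ha Hb ->]]] := quotient_frac x.
apply: (@sub_finite_set _ _ ([set p | X p /\ p a] `|` [set p | X p /\ p b])).
  move=> p [Xp nU]; have [pa|npa] := pselect (p a); first by left.
  have [pb|npb] := pselect (p b); first by right.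
  case: nU; apply: (units_submonoid (loc_submonoid Hm (mpp Xp))).2.
    exact: loc_unit (mpp Xp) Ha npa.
  exact: unitsV (loc_unit Hm (mpp Xp) Hb npb).
by rewrite finite_setU; split; apply: HwK.2.
Qed.

Lemma loc_finite x : finite_set [set p | X p /\ ~ loc p x].
Proof.
apply: sub_finite_set (loc_nonunit_finite x) => p [Xp nx].
by split=> // -[].
Qed.

Variables (s al : set G -> nat) (v : set G -> nat -> G -> int).
Hypothesis Hv : forall p, X p -> valued (loc p) (s p) (al p) (v p).

Lemma vM p i x y : X p -> v p i (x * y) = (v p i x + v p i y)%R.
Proof. by move/Hv/valued_mul. Qed.

Lemma v1 p i : X p -> v p i 1 = 0%R.
Proof. by move/Hv/valued_mul => E; exact: intmor1. Qed.

Lemma vV p i x : X p -> v p i x^-1 = (- v p i x)%R.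
Proof. by move/Hv/valued_mul => E; exact: intmorV. Qed.

Lemma vX p i x n : X p -> v p i (x ^+ n) = (n%:Z * v p i x)%R.
Proof. by move/Hv/valued_mul => E; exact: intmorX. Qed.

Lemma v_ge0 p i x : X p -> (i < s p)%N -> loc p x -> (0 <= v p i x)%R.
Proof. by move=> /Hv Vp si; exact: valued_ge0 Vp _ _ si. Qed.

Lemma v_unit p i x : X p -> (i < s p)%N -> units (loc p) x -> v p i x = 0%R.
Proof.
move=> Xp si [Lx Lx']; have := v_ge0 Xp si Lx; have := v_ge0 Xp si Lx'.
rewrite vV //; lia.
Qed.

Lemma v_eq0 p i x : X p -> (i < s p)%N -> loc p x -> v p i x = 0%R ->
  units (loc p) x.
Proof. by move=> Xp si Lx v0; split=> //;
  exact: (valued_unit (Hv Xp) si Lx v0). Qed.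

Lemma v_gt0 p i x : X p -> (i < s p)%N -> p x -> (0 < v p i x)%R.
Proof.
move=> Xp si px; have Lx : loc p x by apply: loc_sub => //;
  [exact: mpp | exact: min_prime_sub px].
rewrite Order.POrderTheory.lt_neqAle v_ge0 // andbT; apply/eqP => v0.
have [_] := v_eq0 Xp si Lx (esym v0); exact: loc_nonunit (mpp Xp) px.
Qed.

Lemma v_mem p i x : X p -> (i < s p)%N -> H x -> (0 < v p i x)%R -> p x.
Proof.
move=> Xp si Hx vx; apply: contrapT => npx.
by move: vx; rewrite (v_unit Xp si (loc_unit Hm (mpp Xp) Hx npx)).
Qed.

Lemma v_conductor p x : X p ->
  (forall i, (i < s p)%N -> ((al p)%:Z <= v p i x)%R) -> loc p x.
Proof. by move=> Xp; exact: valued_conductor (Hv Xp) x. Qed.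

Lemma s_gt0 p : X p -> (0 < s p)%N.
Proof. by move/Hv/valued_rank. Qed.

(** All valuations of [t] at [p] are at least 1, so a large power outweighs the negative valuations
    of [x] and reaches the conductor bound. *)
Lemma loc_power p t x : X p -> p t -> exists n, loc p (t ^+ n * x).
Proof.
move=> Xp pt; exists (al p + \sum_(i < s p) `|v p i x|)%N;
  apply: v_conductor => // i si.
rewrite vM // vX //; have vt := v_gt0 Xp si pt.
have : (`|v p i x| <= \sum_(i < s p) `|v p i x|)%N.
  by rewrite (bigD1 (Ordinal si)) //= leq_addr.
nia.
Qed.

(** For each bad prime other than [p], a power of one of its elements outside [p] clears the
    denominator; the product of these powers stays outside [p]. As [t] is a unit at [p], local data
    there become global without a change of valuation. *)
Lemma approximation p (y : set G -> G) : X p ->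
  finite_set [set p' | X p' /\ ~ loc p' (y p')] ->
  exists t, [/\ H t, ~ p t & forall p', X p' -> p' <> p -> loc p' (t * y p')].
Proof.
move=> Xp /finite_seqP[r rE].
have ex p' : exists t, X p' -> p' <> p -> [/\ H t, ~ p t & loc p' (t * y p')].
  have [[Xp' np]|nX] := pselect (X p' /\ p' <> p); last by exists 1 => ? ?;
    case: nX.
  have [t [p't npt]] := min_prime_sep Xp Xp' np.
  have [n Ln] := loc_power (y p') Xp' p't; exists (t ^+ n) => _ _.
  have Ht := min_prime_sub Xp' p't.
  by split=> //; [exact: submonoidX | exact: primeX_notin (mpp Xp) Ht npt].
have [g gP] := choice ex.
pose r' := [seq p' <- r | p' != p].
have rX p' : p' \in r' -> X p' /\ p' <> p.
  rewrite mem_filter => /andP[/eqP np p'r]; split=> //.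
  by have : [set` r] p' by []; rewrite -rE => -[].
have [Ht npt] : H (\prod_(q <- r') g q) /\ ~ p (\prod_(q <- r') g q).
  by apply: prime_prod_notin (mpp Xp) _ => q /rX[Xq nq]; case: (gP q Xq nq).
exists (\prod_(q <- r') g q); split=> // q Xq nq.
have Lm := loc_submonoid Hm (mpp Xq).
have [qr|nqr] := boolP (q \in r'); last first.
  apply: Lm.2; first exact: loc_sub (mpp Xq) _ Ht.
  apply: contrapT => nL; move/negP: nqr; apply; rewrite mem_filter; apply/andP;
    split; first exact/eqP.
  by have : [set` r] q by rewrite -rE.
rewrite (big_rem q) //= mulgC mulgA [y q * _]mulgC.
apply: Lm.2; first by case: (gP q Xq nq).
apply: submonoid_prod => // q' /mem_rem /rX[Xq' nq'].
by apply: loc_sub (mpp Xq) _ _; case: (gP q' Xq' nq').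
Qed.

Lemma deep_element (A : set (set G)) (K : set G -> nat) : finite_set A ->
  A `<=` X ->
  exists c, H c /\ forall p, A p ->
    forall i, (i < s p)%N -> ((K p)%:Z <= v p i c)%R.
Proof.
move=> /finite_seqP[r ->] AX.
have ex p : exists t, X p -> p t.
  have [Xp|] := pselect (X p); last by exists 1.
  by have [_ [t pt] _] := Xp; exists t.
have [g gP] := choice ex.
have Hg p : p \in r -> H (g p ^+ K p).
  by move=> /AX Xp; apply: submonoidX => //; apply: (min_prime_sub Xp); exact: gP.
exists (\prod_(p <- r) g p ^+ K p); split; first exact: submonoid_prod.
move=> p pr i si; have Xp := AX p pr.
rewrite (big_rem p) //=; set w := \prod_(q <- rem p r) _.
rewrite vM // vX //; have := v_gt0 Xp si (gP p Xp).
suff : (0 <= v p i w)%R by nia.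
apply: v_ge0 => //; apply: loc_sub (mpp Xp) _ _ => //.
by apply: submonoid_prod => // q /mem_rem; exact: Hg.
Qed.

(** * The complete integral closure and its minimal primes *)

Local Notation Hhat := (complete_integral_closure H).

(** For the converse, the multiplier is chosen deep enough at the finitely many primes where [x] is
    not local: with nonnegative valuations, all its products with powers of [x] stay above the
    conductor bound. *)
Lemma complete_integral_closureP x :
  Hhat x <-> forall p i, X p -> (i < s p)%N -> (0 <= v p i x)%R.
Proof.
split=> [[c [Hc cx]] p i Xp si|vx].
  have := v_ge0 Xp si (loc_sub Hm (mpp Xp) (cx (`|v p i c|.+1)%N)).
  have := v_ge0 Xp si (loc_sub Hm (mpp Xp) Hc).
  rewrite vM // vX //; nia.
have [c [Hc cdeep]] := deep_element al (loc_finite x) (fun p Bp => Bp.1).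
exists c; split=> // n; apply: mem_of_loc => p Xp.
have Lm := loc_submonoid Hm (mpp Xp).
have [Lx|nLx] := pselect (loc p x).
  by apply: Lm.2; [exact: loc_sub (mpp Xp) _ Hc | exact: submonoidX].
apply: v_conductor => // i si; rewrite vM // vX //.
have := cdeep p (conj Xp nLx) i si; have := vx p i Xp si; nia.
Qed.

Lemma Hhat_sub : H `<=` Hhat.
Proof.
move=> x Hx; apply/complete_integral_closureP => p i Xp si.
by apply: v_ge0 => //; exact: loc_sub (mpp Xp) _ Hx.
Qed.

Lemma Hhat_submonoid : submonoid Hhat.
Proof.
split; first by apply: Hhat_sub; exact: Hm.1.
move=> x y /complete_integral_closureP Hx /complete_integral_closureP Hy.
apply/complete_integral_closureP => p i Xp si; rewrite vM //.
by have := Hx p i Xp si; have := Hy p i Xp si; lia.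
Qed.

(** The centre of the valuation [v p i] on the complete integral closure. *)
Definition hat_prime p i : set G := [set y | Hhat y /\ (0 < v p i y)%R].

Lemma hat_prime_prime p i : X p -> (i < s p)%N ->
  prime_s_ideal Hhat (hat_prime p i).
Proof.
move=> Xp si; have Hmm := Hhat_submonoid; split; first split.
- by move=> y [].
- apply/seteqP; split=> [_ [a [Ha va] [b Hb <-]]|a pa].
    split; first exact: Hmm.2.
    by rewrite vM //; have /complete_integral_closureP/(_ p i Xp si) := Hb; lia.
  by exists a => //; exists 1; rewrite ?mulg1 //; exact: Hmm.1.
- split; first by split; [exact: Hmm.1 | rewrite /hat_prime /= v1 // => -[]].
  move=> a b [Ha na] [Hb nb]; split; first exact: Hmm.2.
  move=> [_]; rewrite vM // => vab.
  have va : ~ (0 < v p i a)%R by move=> va; apply: na.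
  have vb : ~ (0 < v p i b)%R by move=> vb; apply: nb.
  lia.
Qed.

Lemma hat_prime_cap p i : X p -> (i < s p)%N -> hat_prime p i `&` H = p.
Proof.
move=> Xp si; apply/seteqP; split=> [x [[_ vx] Hx]|x px];
  first exact: v_mem Xp si Hx vx.
have Hx := min_prime_sub Xp px.
by split=> //; split; [exact: Hhat_sub | exact: v_gt0].
Qed.

Lemma hat_primeN0 p i : X p -> (i < s p)%N -> hat_prime p i !=set0.
Proof.
move=> Xp si; have [_ [x px] _] := Xp; exists x.
by rewrite -(hat_prime_cap Xp si) in px; case: px.
Qed.

(** Over different primes, an element of [p'] outside [p] separates the centres. Over the same
    prime, approximation lifts an element of valuation 1 at [i'] and 0 at the other indices. *)
Lemma hat_prime_sep p i p' i' : X p -> (i < s p)%N -> X p' -> (i' < s p')%N ->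
  hat_prime p' i' `<=` hat_prime p i -> p' = p /\ i' = i.
Proof.
move=> Xp si Xp' si' sub.
have [E|np] := pselect (p' = p); last first.
  have [t [p't npt]] := min_prime_sep Xp Xp' np.
  have [_ vt] : hat_prime p i t.
    by apply: sub; move: p't; rewrite -{1}(hat_prime_cap Xp' si') => -[].
  have Ht := min_prime_sub Xp' p't.
  by case: npt; exact: v_mem Xp si Ht vt.
split=> //; apply: contrapT => ni; subst p'.
have [x vx] := valued_surj (Hv Xp) (fun j => if j == i' then 1%R else 0%R).
have [t [Ht npt tx]] : exists t, [/\ H t, ~ p t &
  forall p', X p' -> p' <> p -> loc p' (t * x)].
  by apply: approximation => //; exact: loc_finite.
have vt j : (j < s p)%N -> v p j (t * x) = (if j == i' then 1%R else 0%R).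
  by move=> sj; rewrite vM // (v_unit Xp sj (loc_unit Hm (mpp Xp) Ht npt)) vx //
    GRing.add0r.
have [] : hat_prime p i (t * x).
  apply: sub; split; last by rewrite vt // eqxx.
  apply/complete_integral_closureP => q j Xq sj.
  have [E|nq] := pselect (q = p); first by subst q; rewrite vt //; case: ifP.
  exact: v_ge0 (tx q Xq nq).
by rewrite vt //; case: eqP => // E; case: ni.
Qed.

(** Suppose each centre has an element outside [Q]. For [z] in [Q], raise these elements to the
    valuations of [z]: the product is outside [Q] by primality, yet divisible by [z]. *)
Lemma hat_prime_min Q : prime_s_ideal Hhat Q -> Q !=set0 ->
  exists p i, [/\ X p, (i < s p)%N & hat_prime p i `<=` Q].
Proof.
move=> pQ [z Qz]; apply: contrapT => nQ.
have Hz : Hhat z by exact: pQ.1.1.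
have ex (pi : set G * nat) : exists y, X pi.1 -> (pi.2 < s pi.1)%N ->
    hat_prime pi.1 pi.2 y /\ ~ Q y.
  have [[Xp si]|no] := pselect (X pi.1 /\ (pi.2 < s pi.1)%N); last first.
    by exists 1 => Xp si; case: no.
  apply: contrapT => ny; apply: nQ; exists pi.1, pi.2; split=> // y py.
  by apply: contrapT => nQy; apply: ny; exists y.
have [g gP] := choice ex.
have /finite_seqP[r rE] := loc_nonunit_finite z.
have rX p : p \in r -> X p by move=> pr; have : [set` r] p by [];
  rewrite -rE => -[].
pose w := \prod_(p <- r) \prod_(i < s p) g (p, val i) ^+ `|v p i z|.
have gH p i : p \in r -> (i < s p)%N -> Hhat (g (p, i)) /\ ~ Q (g (p, i)).
  by move=> /rX Xp si; have [[]] := gP (p, i) Xp si.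
have gXH p (i : 'I_(s p)) : p \in r ->
    Hhat (g (p, val i) ^+ `|v p i z|) /\ ~ Q (g (p, val i) ^+ `|v p i z|).
  move=> pr; have [Hg nQg] := gH p i pr (ltn_ord i).
  by split; [exact: submonoidX Hhat_submonoid _ _ _ | exact: primeX_notin pQ Hg
    nQg].
have gpH p : p \in r -> Hhat (\prod_(i < s p) g (p, val i) ^+ `|v p i z|) /\
    ~ Q (\prod_(i < s p) g (p, val i) ^+ `|v p i z|).
  by move=> pr; apply: prime_prod_notin => // i _; exact: gXH.
have [Hw nQw] : Hhat w /\ ~ Q w by apply: prime_prod_notin.
apply: nQw; have -> : w = z * (w / z) by abelg.
apply: (s_idealM Hhat_submonoid pQ.1 Qz);
  apply/complete_integral_closureP => p i Xp si.
rewrite vM // vV //.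
have [pr|npr] := boolP (p \in r); last first.
  have Uz : units (loc p) z.
    by apply: contrapT => nU; move/negP: npr; apply;
      have : [set` r] p by rewrite -rE.
  rewrite (v_unit Xp si Uz);
    have /complete_integral_closureP/(_ p i Xp si) := Hw; lia.
pose w1 := \prod_(q <- rem p r) \prod_(i < s q) g (q, val i) ^+ `|v q i z|.
pose w2 := \prod_(j < s p | j != Ordinal si) g (p, val j) ^+ `|v p j z|.
have -> : w = g (p, i) ^+ `|v p i z| * w2 * w1.
  by rewrite /w (big_rem p) //= (bigD1 (Ordinal si)).
have v1w : (0 <= v p i w1)%R.
  apply: (complete_integral_closureP w1).1 => //.
  apply: submonoid_prod; first exact: Hhat_submonoid.
  by move=> q /mem_rem qr; case: (gpH q qr).
have v2w : (0 <= v p i w2)%R.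
  apply: (complete_integral_closureP w2).1 => //.
  rewrite /w2 -big_filter; apply: submonoid_prod; first exact: Hhat_submonoid.
  by move=> j _; case: (gXH p j pr).
rewrite !vM // vX //.
have [[_ /= vg] _] := gP (p, i) Xp si.
by nia.
Qed.

Lemma min_primes_Hhat Q : min_primes Hhat Q <->
  exists p i, [/\ X p, (i < s p)%N & Q = hat_prime p i].
Proof.
split=> [[pQ Q0 Qmin]|[p [i [Xp si ->]]]].
  have [p [i [Xp si sub]]] := hat_prime_min pQ Q0; exists p, i; split=> //.
  by rewrite (Qmin (hat_prime p i)) //;
    [exact: hat_prime_prime | exact: hat_primeN0].
split; [exact: hat_prime_prime | exact: hat_primeN0 |] => q pq q0 qsub.
have [p' [i' [Xp' si' sub]]] := hat_prime_min pq q0.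
have [Ep Ei] := hat_prime_sep Xp si Xp' si' (subset_trans sub qsub).
by apply/seteqP; split=> //; rewrite -Ep -Ei.
Qed.

(** The fibre of the contraction over [p] consists of the [s p] pairwise incomparable centres
    [hat_prime p i]. *)
Lemma contraction_bij :
  set_bij (min_primes Hhat) X (fun q : set G => q `&` H) <->
  forall p, X p -> s p = 1%N.
Proof.
split=> [[_ inj _] p Xp|s1].
  have s0 := s_gt0 Xp; have [|s2] := leqP (s p) 1%N; first by lia.
  have E : hat_prime p 0 = hat_prime p 1.
    apply: inj; rewrite ?inE; try (apply/min_primes_Hhat; eexists; eexists;
      split; [exact: Xp| |reflexivity]; lia).
    by rewrite !hat_prime_cap.
  have sub : hat_prime p 0 `<=` hat_prime p 1 by rewrite E.
  by have [] := hat_prime_sep Xp s2 Xp s0 sub.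
split.
- by move=> _ /min_primes_Hhat[p [i [Xp si ->]]]; rewrite hat_prime_cap.
- move=> Q Q'; rewrite !inE =>
  /min_primes_Hhat[p [i [Xp si ->]]] /min_primes_Hhat[p' [i' [Xp' si' ->]]].
  rewrite !hat_prime_cap // => E; subst p'; move: si si'; rewrite s1 //.
  by case: i i' => [|?] [|?].
- move=> p Xp; exists (hat_prime p 0); last by rewrite hat_prime_cap // s_gt0.
  by apply/min_primes_Hhat; exists p, 0%N; split=> //; exact: s_gt0.
Qed.

(** Approximation puts [t * x] into the complete integral closure, and an element [c] of the
    conductor outside [p] moves it into [H]; both [t] and [c] are units at [p]. *)
Lemma loc_regular p x : X p -> ~ (conductor H `<=` p) ->
  (forall i, (i < s p)%N -> (0 <= v p i x)%R) -> loc p x.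
Proof.
move=> Xp /existsNP[c /not_implyP[cond npc]] vx.
have [t [Ht npt tx]] : exists t, [/\ H t, ~ p t &
  forall p', X p' -> p' <> p -> loc p' (t * x)].
  by apply: approximation => //; exact: loc_finite.
have htx : Hhat (t * x).
  apply/complete_integral_closureP => q j Xq sj.
  have [E|nq] := pselect (q = p); last exact: v_ge0 (tx q Xq nq).
  by subst q; rewrite vM // (v_unit Xp sj (loc_unit Hm (mpp Xp) Ht npt))
    GRing.add0r vx.
have Hc : H c by rewrite -[c]mulg1; apply: cond; exact: Hhat_submonoid.1.
have -> : x = (c * (t * x)) * c^-1 * t^-1 by abelg.
have Lm := loc_submonoid Hm (mpp Xp).
apply: Lm.2; last exact: loc_inv (mpp Xp) Ht npt.
apply: Lm.2; last exact: loc_inv (mpp Xp) Hc npc.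
by apply: loc_sub (mpp Xp) _ _ => //; exact: cond.
Qed.

(** With two valuations, an element of valuations 1, 0, ... would be local by [loc_regular], and
    then a unit because one valuation vanishes. *)
Lemma rank_regular p : X p -> ~ (conductor H `<=` p) -> s p = 1%N.
Proof.
move=> Xp reg; have s0 := s_gt0 Xp; have [|s2] := leqP (s p) 1%N; first by lia.
have [x vx] := valued_surj (Hv Xp) (fun j => if j == 0%N then 1%R else 0%R).
have Lx : loc p x by apply: loc_regular => // i si; rewrite vx //; case: ifP.
have := v_unit Xp s0 (v_eq0 Xp s2 Lx (vx 1%N s2)).
by rewrite vx.
Qed.

(* The sum of one valuation at each of the finitely many minimal primes
   containing [h] bounds the number of factors of [h]. *)
Lemma length_function h : H h -> exists w : G -> int,
  [/\ forall x y, w (x * y) = (w x + w y)%R, forall x, H x -> (0 <= w x)%R &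
    forall x y, H x -> H y -> h = x * y -> ~ units H x -> (0 < w x)%R].
Proof.
move=> Hh; have /finite_seqP[r rE] := HwK.2 h Hh.
have rX p : p \in r -> X p by move=> pr; have : [set` r] p by [];
  rewrite -rE => -[].
exists (fun x => \sum_(p <- r) v p 0 x)%R.
have Hpos x : H x -> forall p, p \in r -> (0 <= v p 0 x)%R.
  move=> Hx p /rX Xp; apply: v_ge0; rewrite ?s_gt0 //.
  exact: loc_sub (mpp Xp) _ Hx.
split.
- move=> x y; rewrite -big_split /=; apply: eq_big_seq => p /rX Xp; exact: vM.
- move=> x Hx; rewrite big_seq; apply: Num.Theory.sumr_ge0 => p; exact: Hpos.
- move=> x y Hx Hy hE nU.
  have [p [Xp px]] : exists p, X p /\ p x.
    apply: contrapT => np; apply: nU; split=> //; apply: mem_of_loc => p Xp.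
    by apply: loc_inv (mpp Xp) Hx _ => // px; apply: np; exists p.
  have pr : p \in r.
    have : [set` r] p; last by [].
    rewrite -rE; split=> //; rewrite hE; exact: s_idealM (mpp Xp).1 px Hy.
  rewrite (big_rem p) //=; set w := (\sum_(q <- rem p r) _)%R.
  have := v_gt0 Xp (s_gt0 Xp) px.
  suff : (0 <= w)%R by lia.
  by rewrite /w big_seq; apply: Num.Theory.sumr_ge0 => q /mem_rem; exact: Hpos.
Qed.

(** A quotient of valuation at least [al p] is local by the conductor bound; one of valuation 0 is
    local once the unit parts lie in the same coset. Fixing the residue modulo [(al p).+1] excludes
    the small positive differences; the successor keeps the modulus positive. *)
Lemma loc_wqo p : X p -> s p = 1%N ->
  finite_set (cosets (units (complete_integral_closure (loc p))) (units (loc p))) ->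
  wqo_on (loc p) (fun x y => loc p (y / x)).
Proof.
move=> Xp s1 /finite_seqP[r rE]; have s0 : (0 < s p)%N by rewrite s1.
have Lm := loc_submonoid Hm (mpp Xp); have Um := units_submonoid Lm.
have [t vt] := valued_surj (Hv Xp) (fun=> 1%R).
have {}vt : v p 0 t = 1%R by rewrite vt.
have cond x : ((al p)%:Z <= v p 0 x)%R -> loc p x.
  by move=> vx; apply: v_conductor => // i; rewrite s1; case: i.
have hat z : v p 0 z = 0%R -> complete_integral_closure (loc p) z.
  move=> vz; exists (t ^+ al p); split=> [|n]; apply: cond.
    by rewrite vX // vt; lia.
  by rewrite vM // !vX // vt vz; lia.
pose n x := `|v p 0 x|%N.
have vn x : loc p x -> v p 0 x = (n x)%:Z%R by move=> Lx; have := v_ge0 Xp s0 Lx;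
  rewrite /n; lia.
pose cs x := mulset [set x / t ^+ n x] (units (loc p)).
have csr x : loc p x -> cs x \in r.
  move=> Lx; suff : [set` r] (cs x) by [].
  rewrite -rE; exists (x / t ^+ n x) => //.
  have vz : v p 0 (x / t ^+ n x) = 0%R by rewrite vM // vV // vX // vn // vt; lia.
  by split; apply: hat => //; rewrite vV // vz.
have w1 : wqo_on (loc p) (fun x y => index (cs x) r = index (cs y) r).
  apply: (@wqo_eq_nat _ _ (fun x => index (cs x) r) (size r)) => x _;
    exact: index_size.
have w2 : wqo_on (loc p) (fun x y => n x %% (al p).+1 = n y %% (al p).+1)%N.
  apply: (@wqo_eq_nat _ _ (fun x => n x %% (al p).+1)%N (al p).+1) => x _.
  by rewrite ltnW // ltn_mod.
have w3 := @wqo_nat _ (loc p) (fun x => (n x %/ (al p).+1)%N).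
apply: wqo_sub (wqo_and w1 (wqo_and w2 w3)) => x y Lx Ly [] Ei [Em].
rewrite leq_eqVlt => /orP[/eqP Ed|lt_d].
  have En : n x = n y by rewrite (divn_eq (n x) (al p).+1) Ed Em -divn_eq.
  have Ec : cs x = cs y by rewrite -(nth_index set0 (csr x Lx)) Ei nth_index ?csr.
  have : cs y (y / t ^+ n y).
    by exists (y / t ^+ n y) => //; exists 1; rewrite ?mulg1 //; exact: Um.1.
  rewrite -Ec => -[_ -> [e [Le _]]]; rewrite En => E.
  suff -> : y / x = e by [].
  by rewrite -(mulgVK (t ^+ n y) y) -E; abelg.
apply: cond; rewrite vM // vV // !vn //.
have := divn_eq (n x) (al p).+1; have := divn_eq (n y) (al p).+1.
by rewrite Em; nia.
Qed.

(** Divisors of powers of [b] are units outside the finitely many primes containing [b], so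
    divisibility in [H] is a finite conjunction of local well-quasi-orders. Among infinitely many
    pairwise non-associated atoms one would divide another. *)
Lemma finitely_many_atoms b : H b ->
  (forall p, X p -> wqo_on (loc p) (fun x y => loc p (y / x))) ->
  exists N (u : 'I_N -> G), (forall i, atom H (u i)) /\
    forall t n c, atom H t -> H c -> b ^+ n = t * c ->
      exists i e, units H e /\ t = e * u i.
Proof.
move=> Hb wl; have /finite_seqP[r rE] := HwK.2 b Hb.
have rX p : p \in r -> X p by move=> pr; have : [set` r] p by [];
  rewrite -rE => -[].
pose S := [set t | H t /\ forall p, X p -> p t -> p b].
have S_dvd t n c : H t -> H c -> b ^+ n = t * c -> S t.
  move=> Ht Hc E; split=> // p Xp pt; apply: contrapT => npb.
  apply: (primeX_notin (n := n) (mpp Xp) Hb npb); rewrite E.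
  exact: s_idealM (mpp Xp).1 pt Hc.
have wS : wqo_on S (fun x y => H (y / x)).
  apply: (wqo_sub (R := fun x y => forall p, p \in r -> loc p (y / x))).
    move=> x y [Hx xb] [Hy yb] xy; apply: mem_of_loc => p Xp.
    have [/xy//|npr] := boolP (p \in r).
    have npb : ~ p b.
      by move=> pb; move/negP: npr; apply; have : [set` r] p by rewrite -rE.
    apply: (loc_submonoid Hm (mpp Xp)).2; first exact: loc_sub (mpp Xp) _ Hy.
    by apply: loc_inv (mpp Xp) Hx _ => // /(xb p Xp).
  apply: wqo_all => p /rX Xp f Sf; apply: (wl p Xp) => n.
  by apply: loc_sub (mpp Xp) _ _ => //; case: (Sf n).
have [l [lA lP]] : exists l : seq G, (forall x, x \in l -> atom H x) /\
    forall t, S t -> atom H t -> exists x e, [/\ x \in l, units H e & t = e * x].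
  apply: contrapT => no.
  have ex (l : seq G) : exists t, (forall x, x \in l -> atom H x) ->
      [/\ S t, atom H t & forall x e, x \in l -> units H e -> t <> e * x].
    have [lA|nlA] := pselect (forall x, x \in l -> atom H x); last by exists 1.
    apply: contrapT => nt; apply: no; exists l; split=> // t St tA.
    apply: contrapT => nx; apply: nt; exists t => _; split=> // x e xl Ue E.
    by apply: nx; exists x, e.
  have [next nextP] := choice ex.
  pose L n := iter n (fun l => next l :: l) [::].
  have LA n : forall x, x \in L n -> atom H x.
    elim: n => [|n IHn] x //=; rewrite inE => /orP[/eqP->|/IHn//].
    by case: (nextP _ IHn).
  have inL i j : (i < j)%N -> next (L i) \in L j.
    elim: j => // j IHj; rewrite ltnS leq_eqVlt /= inE => /orP[/eqP->|/IHj->].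
      by rewrite eqxx.
    by rewrite orbT.
  have [|g [gm gR]] := wS (fun n => next (L n)); first by move=> n;
    case: (nextP _ (LA n)).
  have /gm g01 : (0 < 1)%N by [].
  have /gR HR : (0 < 1)%N by [].
  have [_ [Hi nUi _] _] := nextP _ (LA (g 0%N)).
  have [_ [_ _ jI] jn] := nextP _ (LA (g 1%N)).
  have [|//|U] := jI _ _ Hi HR; first by rewrite mulgC mulgVK.
  by apply: (jn _ _ (inL _ _ g01) U); rewrite mulgVK.
exists (size l), (fun i => nth 1 l i); split=> [i|t n c tA Hc E].
  by apply: lA; rewrite mem_nth.
have [x [e [xl Ue ->]]] := lP t (S_dvd t n c (atom_sub tA) Hc E) tA.
have il : (index x l < size l)%N by rewrite index_mem.
by exists (Ordinal il), e; rewrite nth_index.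
Qed.

(* A nonunit of minimal support, and then of minimal valuation, lying outside all
   primes that contain the conductor: the valuation vectors of its divisors are
   proportional, so its powers factor uniquely. *)
Lemma absolutely_irreducible_atom b : H b -> ~ units H b ->
  (forall p, X p -> p b -> ~ (conductor H `<=` p)) ->
  exists A, atom H A /\ forall n k, lengths H (A ^+ n) k -> k = n.
Proof.
move=> Hb nUb breg; have /finite_seqP[r rE] := HwK.2 b Hb.
have rXb p : p \in r -> X p /\ p b.
  by move=> pr; have : [set` r] p by []; rewrite -rE.
have rX p : p \in r -> X p by case/rXb.
have rs p : p \in r -> s p = 1%N by case/rXb => Xp /(breg p Xp);
  exact: rank_regular.
have s0 p : p \in r -> (0 < s p)%N by move/rs->.
pose w p x := v p 0 x.
have wM p x y : p \in r -> w p (x * y) = (w p x + w p y)%R by move/rX => Xp;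
  exact: vM.
have wV p x : p \in r -> w p x^-1 = (- w p x)%R by move/rX => Xp; exact: vV.
have wX p x n : p \in r -> w p (x ^+ n) = (n%:Z * w p x)%R by move/rX => Xp;
  exact: vX.
(* The elements supported on [r]. At the regular primes in [r], nonnegative valuation means being
   local, so membership in [H] ([NH]) and invertibility ([NU]) can be read off from the valuations
   [w]. *)
pose NN := [set x | forall p, X p -> p \notin r -> units (loc p) x].
have Um p : X p -> submonoid (units (loc p)).
  by move=> Xp; apply: units_submonoid; exact: loc_submonoid (mpp Xp).
have NM x y : NN x -> NN y -> NN (x * y).
  by move=> Nx Ny p Xp pr; apply: (Um p Xp).2; [exact: Nx | exact: Ny].
have NV x : NN x -> NN x^-1 by move=> Nx p Xp pr; apply: unitsV; exact: Nx.
have NX x n : NN x -> NN (x ^+ n).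
  by move=> Nx p Xp pr; apply: submonoidX (Um p Xp) _ _ _; exact: Nx.
have NH x : NN x -> (forall p, p \in r -> (0 <= w p x)%R) -> H x.
  move=> Nx wx; apply: mem_of_loc => p Xp.
  have [pr|npr] := boolP (p \in r); last by case: (Nx p Xp npr).
  apply: loc_regular => //; first by apply: breg => //; case: (rXb p pr).
  by rewrite (rs p pr); case=> // _; exact: wx.
have Hw x p : H x -> p \in r -> (0 <= w p x)%R.
  by move=> Hx pr; apply: v_ge0 (rX p pr) (s0 p pr) _;
    exact: loc_sub (mpp (rX p pr)) _ Hx.
have NU x : NN x -> (forall p, p \in r -> w p x = 0%R) -> units H x.
  move=> Nx wx; split; first by apply: NH => // p pr; rewrite wx.
  by apply: NH; [exact: NV | move=> p pr; rewrite wV // wx].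
have Ndvd x y : H x -> H y -> NN (x * y) -> NN x.
  move=> Hx Hy Nxy p Xp pr; apply: unitsM_l (Nxy p Xp pr).
  - exact: loc_submonoid (mpp Xp).
  - exact: loc_sub (mpp Xp) _ Hx.
  - exact: loc_sub (mpp Xp) _ Hy.
have Nb : NN b.
  move=> p Xp npr; apply: loc_unit (mpp Xp) Hb _ => // pb; move/negP: npr; apply.
  by have : [set` r] p by rewrite -rE.
pose cnt x := count (fun p => 0 < w p x)%R r.
(* Minimal support: an element of [H] in [NN] whose support is strictly smaller than that of [A1] is
   a unit. *)
have [A1 [[HA1 NA1 nUA1] cmin]] : exists A1, [/\ H A1, NN A1 & ~ units H A1] /\
    forall y, [/\ H y, NN y & ~ units H y] -> (cnt A1 <= cnt y)%N.
  have ex : exists n, `[< exists x, [/\ H x, NN x & ~ units H x] /\ cnt x = n >].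
    by exists (cnt b); apply/asboolP; exists b.
  have := ex_minnP ex; case=> n /asboolP[x [Px <-]] nmin; exists x; split=> // y Py.
  by apply: nmin; apply/asboolP; exists y.
have pos x : H x -> NN x -> ~ units H x -> exists2 p, p \in r & (0 < w p x)%R.
  move=> Hx Nx nU; apply: contrapT => no; apply: nU; apply: NU => // p pr.
  by apply/eqP/negP => /negP wx; apply: no; exists p => //; have := Hw x p Hx pr;
    lia.
have [p1 p1r w1] := pos A1 HA1 NA1 nUA1.
pose C h := [/\ H h, NN h & forall p, p \in r -> (0 < w p h)%R -> (0 < w p A1)%R].
have prop h p : C h -> p \in r -> (w p h * w p1 A1 = w p A1 * w p1 h)%R.
  move=> [Hh Nh hA1] pr.
  have [p2 p2r [w2 ratio]] : exists2 p2, p2 \in r & (0 < w p2 A1)%R /\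
      forall q, q \in r -> (w p2 h * w q A1 <= w q h * w p2 A1)%R.
    by apply: min_ratio p1r w1 => q qr; split; exact: Hw.
  (* As [p2] minimizes the ratio of the valuations of [h] and [A1], this quotient has valuation 0 at
     [p2] and nonnegative valuations elsewhere. Its support is smaller than that of [A1], so it is a
     unit, and the two valuation vectors are proportional. *)
  pose B := h ^+ `|w p2 A1| / A1 ^+ `|w p2 h|.
  have h2 := Hw h p2 Hh p2r.
  have wB q : q \in r -> w q B = (w q h * w p2 A1 - w q A1 * w p2 h)%R.
    by move=> qr; rewrite wM // wV // !wX //; lia.
  have NB : NN B by apply: NM; [exact: NX | apply: NV; exact: NX].
  have HB : H B by apply: NH => // q qr; rewrite wB //; have := ratio q qr; lia.
  have UB : units H B.
    apply: contrapT => nU; have := cmin B (And3 HB NB nU);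
      rewrite leqNgt => /negP; apply.
    have sub q : q \in r -> (0 < w q B)%R -> (0 < w q A1)%R.
      move=> qr; rewrite wB // => wq; apply: hA1 => //.
      have := Hw A1 q HA1 qr; nia.
    have B2 : w p2 B = 0%R by rewrite wB // GRing.mulrC GRing.subrr.
    by apply: ltn_count p2r _ _; rewrite ?w2 ?B2.
  have B0 q : q \in r -> w q B = 0%R.
    move=> qr; have [_ HB'] := UB; have := Hw _ q HB qr; have := Hw _ q HB' qr.
    by rewrite wV //; lia.
  have Ep := B0 p pr; have E1 := B0 p1 p1r; rewrite !wB // in Ep E1.
  have w20 : w p2 A1 != 0%R by lia.
  have {}Ep : (w p h * w p2 A1 = w p A1 * w p2 h)%R by lia.
  have {}E1 : (w p1 h * w p2 A1 = w p1 A1 * w p2 h)%R by lia.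
  apply: (GRing.mulIf w20); rewrite GRing.mulrAC Ep -[RHS]GRing.mulrA E1; ring.
have wC h p : C h -> p \in r -> (0 <= w p h)%R by move=> [Hh _ _]; exact: Hw.
have C1 h : C h -> ~ units H h -> (0 < w p1 h)%R.
  move=> Ch nU; have := wC h p1 Ch p1r;
    rewrite Order.POrderTheory.le_eqVlt => /orP[/eqP h0|//].
  case: nU; have [_ Nh _] := Ch; apply: NU => // p pr.
  by have := prop h p Ch pr; rewrite -h0; nia.
have [A [[CA nUA] Amin]] : exists A, (C A /\ ~ units H A) /\
    forall h, C h -> ~ units H h -> (w p1 A <= w p1 h)%R.
  have ex : exists n, `[< exists x, [/\ C x, ~ units H x & w p1 x = n%:Z%R] >].
    exists `|w p1 A1|%N; apply/asboolP; exists A1; split=> //.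
    by lia.
  have := ex_minnP ex; case=> n /asboolP[x [Cx nUx wx]] nmin; exists x;
    split=> // h Ch nUh.
  rewrite wx; have h1 := C1 h Ch nUh.
  suff : (n <= `|w p1 h|)%N by lia.
  by apply: nmin; apply/asboolP; exists h; split=> //; lia.
have A1pos := C1 A CA nUA; have [HA NA _] := CA.
have Cdvd x y : H x -> H y -> C (x * y) -> C x.
  move=> Hx Hy [Hxy Nxy xyC]; split=> //; first exact: Ndvd Hy Nxy.
  by move=> p pr wx; apply: xyC => //; rewrite wM //; have := Hw y p Hy pr; lia.
(* Euclidean division by [A]: by proportionality the remainder at [p1] controls all other
   valuations, so the quotient lies in [H]; minimality of [A] makes it a unit. *)
have powA h : C h -> exists j, units H (h / A ^+ j).
  move=> Ch; have [Hh Nh hC] := Ch; have wh := wC h p1 Ch p1r.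
  pose j := (`|w p1 h| %/ `|w p1 A|)%N; exists j.
  have hj : (w p1 h = j%:Z * w p1 A + (`|w p1 h| %% `|w p1 A|)%:Z)%R.
    by have := divn_eq `|w p1 h| `|w p1 A|; rewrite -/j; lia.
  have wq p : p \in r -> w p (h / A ^+ j)%g = (w p h - j%:Z * w p A)%R.
    by move=> pr; rewrite wM // wV // wX.
  have Nq : NN (h / A ^+ j) by apply: NM => //; apply: NV; exact: NX.
  have wq0 p : p \in r -> (0 <= w p (h / A ^+ j)%g)%R.
    move=> pr; rewrite wq //.
    set d := (`|w p1 h| %% `|w p1 A|)%N in hj.
    have E : ((w p h - j%:Z * w p A) * w p1 A1 = w p A1 * d%:Z)%R.
      rewrite GRing.mulrBl (prop h p Ch pr) -GRing.mulrA (prop A p CA pr) hj; ring.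
    have := Hw A1 p HA1 pr; move: E w1; nia.
  have Cq : C (h / A ^+ j).
    split=> //; first exact: NH.
    by move=> p pr; rewrite wq // => wp; apply: hC => //; have := wC A p CA pr; nia.
  apply: contrapT => nU; have := Amin _ Cq nU; rewrite wq //.
  have : (`|w p1 h| %% `|w p1 A| < `|w p1 A|)%N by rewrite ltn_mod; lia.
  lia.
have wpow h j p : p \in r -> units H (h / A ^+ j) -> w p h = (j%:Z * w p A)%R.
  move=> pr [Hu Hu']; have := Hw _ p Hu pr; have := Hw _ p Hu' pr.
  by rewrite wV // wM // wV // wX //; lia.
have unit1 h : C h -> w p1 h = 0%R -> units H h.
  by move=> Ch h0; apply: contrapT => /(C1 h Ch); rewrite h0.
have AA : atom H A.
  split=> // x y Hx Hy E; have Cx : C x by apply: (Cdvd x y); rewrite -?E.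
  have Cy : C y by apply: (Cdvd y x); rewrite // mulgC -E.
  have [i /(wpow _ _ _ p1r) wi] := powA x Cx;
    have [j /(wpow _ _ _ p1r) wj] := powA y Cy.
  have : w p1 A = (w p1 x + w p1 y)%R by rewrite E wM.
  rewrite wi wj => EA.
  have [i0|j0] : i = 0%N \/ j = 0%N by nia.
    by left; apply: unit1 => //; rewrite wi i0 GRing.mul0r.
  by right; apply: unit1 => //; rewrite wj j0 GRing.mul0r.
exists A; split=> // n k /(lengthsP Hm)[e [l [[Ue lA E] <-]]].
have CAn : C (A ^+ n).
  split; [exact: submonoidX | exact: NX |] => p pr; rewrite wX // => wp.
  by have [_ _ suppA] := CA; apply: suppA => //; nia.
(* Every factor is a unit times [A ^+ j]; j = 0 contradicts that it is a nonunit, and j at least 2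
   would split the atom. *)
have wl x : x \in l -> w p1 x = w p1 A.
  move=> xl; have xA := lA x xl; have [Hx nUx xI] := xA.
  have Cx : C x.
    apply: (Cdvd x (e * \prod_(y <- rem x l) y)) => //.
      apply: Hm.2; first by case: Ue.
      by apply: prod_atoms_sub => // y /mem_rem /lA.
    by have -> : x * (e * \prod_(y <- rem x l) y) = A ^+ n by rewrite E [in
      RHS](big_rem x) //= mulgCA.
  have [[|[|j]] Uj] := powA x Cx; have wj := wpow _ _ p1 p1r Uj.
  - by case: nUx; apply: unit1 => //; rewrite wj GRing.mul0r.
  - by rewrite wj GRing.mul1r.
  - have Hf : H ((x / A ^+ j.+2) * A) by apply: Hm.2 => //; case: Uj.
    have Hg : H (A ^+ j.+1) by exact: submonoidX.
    have Ex : x = ((x / A ^+ j.+2) * A) * A ^+ j.+1 by rewrite -mulgA -expgS mulgVK.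
    have U0 z : units H z -> w p1 z = 0%R.
      by move=> [Hz Hz']; have := Hw _ p1 Hz p1r; have := Hw _ p1 Hz' p1r;
        rewrite wV //; lia.
    have [/U0|/U0] := xI _ _ Hf Hg Ex; first by rewrite wM // (U0 _ Uj); lia.
    by rewrite wX //; nia.
have : w p1 (A ^+ n) = ((size l)%:Z * w p1 A)%R.
  rewrite E wM // (_ : w p1 e = 0%R); last first.
    by have [He He'] := Ue; have := Hw _ p1 He p1r; have := Hw _ p1 He' p1r;
      rewrite wV //; lia.
  rewrite GRing.add0r (intmor_prod (w := w p1)); last by move=> *; rewrite wM.
  elim: (l) wl => [|x l' IHl] wl; first by rewrite big_nil GRing.mul0r.
  rewrite big_cons wl ?mem_head // IHl; last by move=> y yl; apply: wl;
    rewrite inE yl orbT.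
  by rewrite /=; lia.
by rewrite wX // => /(GRing.mulIf _); lia.
Qed.

End WeaklyKrull.

(** * Invertible ideals and their classes through local generators *)

Section LocalIdeals.
Variables (G : comGroupType) (H : monoid_in G).
Hypothesis HwK : weakly_Krull H.
Variables (s al : set G -> nat) (v : set G -> nat -> G -> int).
Local Notation X := (min_primes H).
Local Notation loc := (localization H).
Hypothesis Hv : forall p, X p -> valued (loc p) (s p) (al p) (v p).
Implicit Types (p : set G) (x y : G) (phi psi : set G -> G) (I J : v_ideal_group H).

Let Hm := carrier_submonoid H.
Let Hq := carrier_quotient H.
Let Lm p (Xp : X p) : submonoid (loc p) := loc_submonoid Hm (min_prime_prime Xp).
Let Ls p (Xp : X p) : H `<=` loc p := loc_sub Hm (min_prime_prime Xp).

Definition admissible phi := finite_set [set p | X p /\ ~ units (loc p) (phi p)].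

(* A family of local generators [phi], almost all of them units, and the
   fractional ideal it defines; these are the v-invertible fractional v-ideals. *)
Definition local_ideal phi : set G :=
  [set x | forall p, X p -> loc p (x / phi p)].

Lemma admissibleM phi psi : admissible phi -> admissible psi ->
  admissible (fun p => phi p * psi p).
Proof.
move=> fphi fpsi; apply: sub_finite_set (_ : _ `<=` _ `|` _) _; last first.
  by rewrite finite_setU; split; [exact: fphi | exact: fpsi].
move=> p [Xp nU]; have [Uphi|nphi] := pselect (units (loc p) (phi p)); last by left.
have [Upsi|npsi] := pselect (units (loc p) (psi p)); last by right.
by case: nU; exact: (units_submonoid (Lm Xp)).2.
Qed.

Lemma admissibleV phi : admissible phi -> admissible (fun p => (phi p)^-1).
Proof.
apply: sub_finite_set => p [Xp nU]; split=> // U; apply: nU; exact: unitsV.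
Qed.

Lemma admissible_const x : admissible (fun=> x).
Proof. exact: loc_nonunit_finite Hm Hq HwK x. Qed.

Lemma admissible_at p x : admissible (fun q => if q == p then x else 1).
Proof.
apply: sub_finite_set (finite_set1 p) => q [Xq]; case: eqP => // _ nU.
by case: nU; split; rewrite ?invg1; exact: (Lm Xq).1.
Qed.

(** After multiplication by an element outside [p], the prescribed generator itself belongs to the
    global ideal; hence the ideal really has localization [phi p] at [p], and colons can be computed
    prime by prime. *)
Lemma local_ideal_generator phi p : admissible phi -> X p ->
  exists t, [/\ carrier H t, ~ p t & local_ideal phi (t * phi p)].
Proof.
move=> fphi Xp.
have [t [Ht npt tL]] : exists t, [/\ carrier H t, ~ p t &
    forall q, X q -> q <> p -> loc q (t * (phi p / phi q))].
  apply: (approximation Hm Hv Xp).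
  apply: sub_finite_set (admissibleM (admissible_const (phi p)) (admissibleV fphi)).
  by move=> q [Xq nL]; split=> // -[].
exists t; split=> // q Xq; have [->|nq] := pselect (q = p).
  by rewrite mulgK; exact: Ls.
by rewrite -mulgA; exact: tL.
Qed.

Lemma colon_local_ideal phi psi : admissible psi ->
  colon (local_ideal phi) (local_ideal psi) = local_ideal (fun p => phi p / psi p).
Proof.
move=> fpsi; apply/seteqP; split=> [x xJ p Xp|x xJ y yJ p Xp].
  have [t [Ht npt /xJ/(_ p Xp) L]] := local_ideal_generator fpsi Xp.
  have -> : x / (phi p / psi p) = x * (t * psi p) / phi p * t^-1 by abelg.
  by apply: (Lm Xp).2 => //; exact: loc_inv (min_prime_prime Xp) Ht npt.
have -> : x * y / phi p = (x / (phi p / psi p)) * (y / psi p) by abelg.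
by apply: (Lm Xp).2; [exact: xJ | exact: yJ].
Qed.

Lemma local_ideal_const x : local_ideal (fun=> x) = principal H x.
Proof.
apply/seteqP; split=> [y yJ|_ [_ -> [h Hh <-]] p Xp].
  exists x => //; exists (y / x); last by rewrite mulgC mulgVK.
  exact: (mem_of_loc HwK) yJ.
by rewrite mulgC mulKg; exact: Ls.
Qed.

Lemma local_ideal1 : local_ideal (fun=> 1) = H.
Proof. by rewrite local_ideal_const principal1. Qed.

Lemma colonH_local_ideal phi : admissible phi ->
  colon H (local_ideal phi) = local_ideal (fun p => (phi p)^-1).
Proof.
move=> fphi; rewrite -{1}local_ideal1 colon_local_ideal //.
by congr local_ideal; apply: funext => p; rewrite mul1g.
Qed.

Lemma v_closure_local_ideal phi psi : admissible phi -> admissible psi ->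
  v_closure H (mulset (local_ideal phi) (local_ideal psi)) =
  local_ideal (fun p => phi p * psi p).
Proof.
move=> fphi fpsi; rewrite /v_closure colon_mulset colonH_local_ideal //.
rewrite colon_local_ideal // colonH_local_ideal; last first.
  by apply: admissibleM; exact: admissibleV.
by congr local_ideal; apply: funext => p; abelg.
Qed.

Definition is_local I phi := admissible phi /\ videal_set I = local_ideal phi.

Lemma local_videal phi : X !=set0 -> admissible phi -> exists I, is_local I phi.
Proof.
move=> [p Xp] fphi; have fphiV := admissibleV fphi.
have Jfrac psi : admissible psi -> fractional_v_ideal H (local_ideal psi).
  move=> fpsi; have fpsiV := admissibleV fpsi; split.
    have [t [_ _ tJ]] := local_ideal_generator fpsiV Xp.
    have [a [b [Ha Hb E]]] := quotient_frac Hq (t * (psi p)^-1).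
    exists a; split=> // _ [_ -> [y yJ <-]].
    have -> : a = b * (t * (psi p)^-1) by rewrite E; abelg.
    rewrite -mulgA; apply: Hm.2 => //.
    by rewrite -colonH_local_ideal // in tJ; exact: tJ.
  rewrite /v_closure !colonH_local_ideal //; congr local_ideal.
  by apply: funext => q; rewrite invgK.
have inv : v_invertible H (local_ideal phi).
  exists (local_ideal (fun p => (phi p)^-1)); split; first exact: Jfrac.
  rewrite v_closure_local_ideal // -[RHS]local_ideal1; congr local_ideal.
  by apply: funext => q; rewrite mulgV.
by exists (VIdeal (Jfrac phi fphi) inv).
Qed.

Lemma is_localM I J phi psi : is_local I phi -> is_local J psi ->
  is_local (I * J) (fun p => phi p * psi p).
Proof.
move=> [fphi EI] [fpsi EJ]; split; first exact: admissibleM.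
by rewrite /= EI EJ v_closure_local_ideal.
Qed.

Lemma is_localV I phi : is_local I phi -> is_local I^-1 (fun p => (phi p)^-1).
Proof.
move=> [fphi EI]; split; first exact: admissibleV.
by rewrite videal_invE EI colonH_local_ideal.
Qed.

Lemma is_local_principal x : is_local (principal_videal H x) (fun=> x).
Proof. by split; [exact: admissible_const | rewrite local_ideal_const]. Qed.

(** This turns an equality of ideals, in particular a product being principal, into a unit statement
    at each prime. *)
Lemma is_local_inj I phi psi p : is_local I phi -> is_local I psi -> X p ->
  units (loc p) (phi p / psi p).
Proof.
have half (phi' psi' : set G -> G) : is_local I phi' -> is_local I psi' -> X p ->
    loc p (phi' p / psi' p).
  move=> [fphi EI] [fpsi EJ] Xp.
  have [t [Ht npt]] := local_ideal_generator fphi Xp.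
  rewrite -EI EJ => /(_ p Xp) L.
  have -> : phi' p / psi' p = t * phi' p / psi' p * t^-1 by abelg.
  by apply: (Lm Xp).2 => //; exact: loc_inv (min_prime_prime Xp) Ht npt.
by move=> lphi lpsi Xp; split; [|rewrite invgF]; exact: half.
Qed.

Lemma is_local_prime I p t : X p -> ~ (conductor H `<=` p) -> v p 0 t = 1%R ->
  videal_set I = p -> is_local I (fun q => if q == p then t else 1).
Proof.
move=> Xp reg vt EI; split; first exact: admissible_at.
have s1 := rank_regular Hm Hq HwK Hv Xp reg; have s0 : (0 < s p)%N by rewrite s1.
have Lp x : (0 <= v p 0 x)%R -> loc p x.
  move=> vx; apply: (loc_regular Hm Hq HwK Hv Xp reg) => i.
  by rewrite s1; case: i.
rewrite EI; apply/seteqP; split=> [x px q Xq|x xJ].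
  have Hx := min_prime_sub Xp px.
  case: eqP => [E|_]; last by rewrite invg1 mulg1; exact: Ls.
  subst q; apply: Lp; rewrite (vM Hv) // (vV Hv) // vt.
  by have := v_gt0 Hm Hv Xp s0 px; lia.
have xp := xJ p Xp; rewrite eqxx in xp.
have Lt : loc p t by apply: Lp; rewrite vt.
have Hx : carrier H x.
  apply: (mem_of_loc HwK) => q Xq; have := xJ q Xq.
  case: eqP => [E|_]; last by rewrite invg1 mulg1.
  by subst q => L; rewrite -(mulgVK t x); exact: (Lm Xq).2.
apply: (v_mem Hm Hv Xp s0 Hx).
have := v_ge0 Hv Xp s0 xp; rewrite (vM Hv) // (vV Hv) // vt; lia.
Qed.

Lemma v_class1 : v_class (1 : v_ideal_group H) = 0%R. Proof. by []. Qed.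

Lemma v_class_eq0 I : v_class I = 0%R -> exists x, I = principal_videal H x.
Proof. by rewrite -v_class1 => /v_classP[x E]; exists x;
  rewrite -E invg1 mulg1. Qed.

Lemma v_classD I J : v_class (I * J) = (v_class I + v_class J)%R.
Proof. exact: v_classM. Qed.

Local Notation P := (X `\` [set p | X p /\ conductor H `<=` p]).

Lemma regularP p : P p -> X p /\ ~ (conductor H `<=` p).
Proof. by move=> [Xp np]; split=> // cp; apply: np. Qed.

Lemma uniformizer p : X p -> exists t, v p 0 t = 1%R.
Proof.
move=> Xp; have [t vt] := valued_surj (Hv Xp) (fun=> 1%R).
by exists t; rewrite vt // (s_gt0 Hv Xp).
Qed.

(** The ideal is a product of primes of [P], one in each class of the sequence. The last clause,
    that a nonempty product is proper, is what later makes a generator a nonunit. *)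
Lemma sequence_ideal (r : seq (v_class_group H)) :
  (forall g, g \in r -> classes_of H P g) ->
  exists I phi, [/\ is_local I phi, v_class I = (\sum_(g <- r) g)%R,
    forall p, X p -> loc p (phi p),
    forall p, X p -> conductor H `<=` p -> units (loc p) (phi p) &
    r <> [::] -> exists p, X p /\ ~ units (loc p) (phi p)].
Proof.
elim: r => [|g r IHr] rP.
  exists 1, (fun=> 1); split;
    [exact: is_local_principal | by rewrite big_nil | | |by []].
  - by move=> p Xp; exact: (Lm Xp).1.
  - by move=> p Xp _; split; rewrite ?invg1; exact: (Lm Xp).1.
have [I [phi [Iphi Ir phi0 phiU _]]] := IHr (fun g' g'r =>
  rP g' (mem_behead (s := g :: r) g'r)).
have [J [PJ Jg]] := rP g (mem_head _ _).
have [Xp reg] := regularP PJ; have [t vt] := uniformizer Xp.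
have s1 := rank_regular Hm Hq HwK Hv Xp reg; have s0 : (0 < s J)%N by rewrite s1.
have Lt : loc J t.
  apply: (loc_regular Hm Hq HwK Hv Xp reg) => i.
  by rewrite s1; case: i => // _; rewrite vt.
exists (J * I), (fun p => (if p == videal_set J then t else 1) * phi p); split.
- exact: is_localM (is_local_prime Xp reg vt erefl) Iphi.
- by rewrite v_classD Jg Ir big_cons.
- move=> p Xp'; apply: (Lm Xp').2; last exact: phi0.
  by case: eqP => [->|_] //; exact: (Lm Xp').1.
- move=> p Xp' cp; case: eqP => [E|_]; last by rewrite mul1g; exact: phiU.
  by case: reg; rewrite -E.
- move=> _; exists (videal_set J); split=> //; rewrite eqxx => U.
  have := v_unit Hv Xp s0 U; rewrite (vM Hv) // vt.
  have := v_ge0 Hv Xp s0 (phi0 _ Xp); lia.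
Qed.

(** The product of primes attached to a nontrivial zero-sum sequence is principal; its generator is
    the starting point for the atom [A]. *)
Lemma regular_nonunit : zero_sum_sequences (classes_of H P) <> [set mset0] ->
  exists b, [/\ carrier H b, ~ units H b &
    forall p, X p -> p b -> ~ (conductor H `<=` p)].
Proof.
move=> nB; have [S [SP S0 SN]] : exists S : {mset (v_class_group H)}%mset,
    [/\ forall g, g \in S -> classes_of H P g,
      (\sum_(g <- S) g = 0)%R & S <> mset0].
  apply: contrapT => no; apply: nB; apply/seteqP; split=> [S [SP S0]|_ ->].
    by apply: contrapT => SN; apply: no; exists S.
  by split=> [g|]; rewrite ?in_mset0 // big_mset0.
have [|I [phi [Iphi IS phi0 phiU phiN]]] := @sequence_ideal (enum_mset S).
  by move=> g gS; exact: SP.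
have [x Ix] := v_class_eq0 (etrans IS S0).
have xphi p : X p -> units (loc p) (phi p / x).
  by move=> Xp; apply: is_local_inj Iphi _ Xp; rewrite Ix;
    exact: is_local_principal.
have Lx p : X p -> loc p x.
  move=> Xp; have -> : x = (phi p / x)^-1 * phi p by abelg.
  by apply: (Lm Xp).2; [case: (xphi p Xp) | exact: phi0].
have Hx := mem_of_loc HwK Lx.
exists x; split=> //.
- move=> [_ Hx']; have [|p [Xp nU]] := phiN.
    move=> E; have [//|[g gS]] := mset_0Vmem S.
    by have : g \in enum_mset S by []; rewrite E.
  apply: nU; rewrite -(mulgVK x (phi p)); apply: (units_submonoid (Lm Xp)).2;
    first exact: xphi.
  by split; exact: Ls.
- move=> p Xp px cp; apply: (loc_nonunit Hm (min_prime_prime Xp) px).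
  have -> : x^-1 = (phi p / x) * (phi p)^-1 by abelg.
  by apply: (Lm Xp).2; [case: (xphi p Xp) | case: (phiU p Xp cp)].
Qed.

Lemma prime_elt_of_class0 : classes_of H P 0%R -> exists x, prime_elt H x.
Proof.
move=> [I [PI /v_class_eq0[x Ix]]]; have [Xp _] := regularP PI; exists x.
have pp := min_prime_prime Xp.
have E : videal_set I = principal H x by rewrite Ix.
have Ix1 : videal_set I x by rewrite E; exists x => //; exists 1;
  rewrite ?mulg1 //; exact: Hm.1.
have dvdE a : videal_set I a <-> divides H x a.
  by rewrite E; split=> [[_ -> [c Hc <-]]|[c [Hc ->]]];
    [exists c | exists x => //; exists c].
split; first exact: min_prime_sub Ix1.
- by move=> [_ Hx']; apply: (prime_notin1 pp); rewrite -(mulgV x);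
  exact: s_idealM pp.1 _ _.
- move=> a b Ha Hb /dvdE Iab; rewrite -!dvdE; exact: primeM pp Ha Hb Iab.
Qed.

(** The ideal generated by [f] at [p0] and trivial elsewhere need not be principal. Multiplying by a
    prime of [P] in the opposite class makes it so, at the cost of that one prime [p]. *)
Lemma local_element p0 f : X p0 -> conductor H `<=` p0 -> classes_of H P = setT ->
  exists b p, [/\ X p, ~ (conductor H `<=` p), p <> p0,
    units (loc p0) (b / f) & v p 0 b = 1%R /\
    forall q, X q -> q <> p0 -> q <> p -> units (loc q) b].
Proof.
move=> Xp0 cp0 PT.
have [I Iphi] := local_videal (ex_intro _ p0 Xp0) (admissible_at p0 f).
have [J [PJ JI]] : classes_of H P (- v_class I)%R by rewrite PT.
have [Xp reg] := regularP PJ; have [t vt] := uniformizer Xp.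
have np : videal_set J <> p0 by move=> E; apply: reg; rewrite E.
have := v_classD I J; rewrite JI GRing.subrr => /v_class_eq0[b Eb].
have Jloc := is_local_prime Xp reg vt erefl.
have IJ := is_localM Iphi Jloc.
have Ub q : X q -> units (loc q) (b / ((if q == p0 then f else 1) * (if q ==
  videal_set J then t else 1))).
  by move=> Xq; apply: is_local_inj IJ Xq; rewrite Eb; exact: is_local_principal.
exists b, (videal_set J); split=> //.
- have := Ub p0 Xp0; rewrite eqxx; case: eqP => [/esym//|_].
  by rewrite mulg1.
- split=> [|q Xq nq nq'].
    have := Ub _ Xp; rewrite eqxx; case: eqP => // _; rewrite mul1g => U.
    have := v_unit Hv Xp (s_gt0 Hv Xp) U; rewrite (vM Hv) // (vV Hv) // vt; lia.
  by have := Ub q Xq; case: eqP => // _; case: eqP => // _;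
    rewrite mul1g invg1 mulg1.
Qed.

(** Two of the ideals generated by powers of [f] at [p0] have the same class; their quotient is
    principal and trivial away from [p0]. *)
Lemma local_power p0 f : X p0 -> finite_set [set: v_class_group H] ->
  exists n theta, [/\ (0 < n)%N, units (loc p0) (theta / f ^+ n) &
    forall q, X q -> q <> p0 -> units (loc q) theta].
Proof.
move=> Xp0 /finite_seqP[r rE].
have ex n : exists I, is_local I (fun q => if q == p0 then f ^+ n else 1).
  by apply: local_videal; [exists p0 | exact: admissible_at].
have [I IP] := choice ex.
have wI : wqo_on [set: nat] (fun m n =>
  index (v_class (I m)) r = index (v_class (I n)) r).
  by apply: (@wqo_eq_nat _ _ (fun n => index (v_class (I n)) r) (size r)) => n _;
    exact: index_size.
have [g [gm gE]] := wI id (fun=> Logic.I).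
have /gm : (0 < 1)%N by [].
have /gE : (0 < 1)%N by [].
move: (g 0%N) (g 1%N) => i j /= Eij ij.
have inr n : v_class (I n) \in r by have : [set` r] (v_class (I n)) by rewrite -rE.
have /esym/v_classP[theta Et] : v_class (I i) = v_class (I j).
  by rewrite -(nth_index 0%R (inr i)) Eij nth_index.
have := is_localM (IP j) (is_localV (IP i)); rewrite Et => L.
have U q : X q -> units (loc q) (theta / ((if q == p0 then f ^+ j else 1) *
    (if q == p0 then f ^+ i else 1)^-1)).
  by move=> Xq; apply: is_local_inj L Xq; exact: is_local_principal.
exists (j - i)%N, theta; split; first by rewrite subn_gt0.
  by rewrite expgnFr 1?ltnW //; have := U p0 Xp0; rewrite eqxx.
by move=> q Xq nq; have := U q Xq; case: eqP => // _;
  rewrite invg1 mulg1 invg1 mulg1.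
Qed.

End LocalIdeals.

Lemma lengthsX (G : comGroupType) (H : set G) (Hm : submonoid H) (a : G) k n :
  lengths H a k -> lengths H (a ^+ n) (n * k)%N.
Proof.
move=> La; elim: n => [|n IHn].
  by apply/lengths_unit; rewrite expg0; exact: (units_submonoid Hm).1.
by rewrite expgS mulSn; exact: lengthsM.
Qed.

(** * Seminormal monoids with a minimal prime of rank at least two *)

Section SeminormalHigherRank.
Variables (G : comGroupType) (H : monoid_in G).
Hypothesis HwK : weakly_Krull H.
Variables (s al : set G -> nat) (v : set G -> nat -> G -> int).
Local Notation X := (min_primes H).
Local Notation loc := (localization H).
Hypothesis Hv : forall p, X p -> valued (loc p) (s p) (al p) (v p).
Hypothesis Hsn : seminormal H.
Implicit Types (p q : set G) (x y t : G).

Let Hm := carrier_submonoid H.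
Let Hq := carrier_quotient H.
Let Lm p (Xp : X p) : submonoid (loc p) := loc_submonoid Hm (min_prime_prime Xp).
Let Ls p (Xp : X p) : H `<=` loc p := loc_sub Hm (min_prime_prime Xp).

(** Positive valuations put all powers from [al p] on into the localization. Once [t] has cleared
    the other primes, these powers lie in [H], and seminormality of [H] applies to [t * x]. *)
Lemma loc_seminormal p x : X p ->
  (forall i, (i < s p)%N -> (0 < v p i x)%R) -> loc p x.
Proof.
move=> Xp vx.
have [t [Ht npt tx]] : exists t, [/\ carrier H t, ~ p t &
    forall q, X q -> q <> p -> loc q (t * x)].
  by apply: (approximation Hm Hv Xp); exact: loc_finite Hm Hq HwK x.
have Htx : carrier H (t * x).
  rewrite Hsn; exists (al p) => n n_al; apply: (mem_of_loc HwK) => q Xq.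
  have [E|nq] := pselect (q = p); last by apply: submonoidX;
    [exact: Lm | exact: tx].
  subst q; apply: (v_conductor Hv Xq) => i si; rewrite (vX Hv) // (vM Hv) //.
  have := v_ge0 Hv Xq si (Ls Xq Ht); have := vx i si; nia.
rewrite -(mulKg t x) mulgC; apply: (Lm Xp).2; first exact: Ls.
exact: loc_inv (min_prime_prime Xp) Ht npt.
Qed.

Variable p0 : set G.
Hypotheses (Xp0 : X p0) (rank_p0 : (1 < s p0)%N).
Hypothesis (GP : classes_of H (X `\` [set p | X p /\ conductor H `<=` p]) = setT).
Hypothesis (Cfin : finite_set [set: v_class_group H]).

(** The group of elements supported at [p0] only; its members need not lie in [H]. *)
Let O := [set x | forall q, X q -> q <> p0 -> units (loc q) x].
Let w i x := v p0 i x.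

Let cp0 : conductor H `<=` p0.
Proof.
apply: contrapT => reg; have := rank_regular Hm Hq HwK Hv Xp0 reg.
by move: rank_p0; lia.
Qed.

Let wM i x y : w i (x * y) = (w i x + w i y)%R. Proof. by rewrite /w (vM Hv). Qed.
Let wV i x : w i x^-1 = (- w i x)%R. Proof. by rewrite /w (vV Hv). Qed.
Let wX i x n : w i (x ^+ n) = (n%:Z * w i x)%R. Proof. by rewrite /w (vX Hv). Qed.
Let s0 : (0 < s p0)%N. Proof. exact: ltnW. Qed.

Let Om : submonoid O.
Proof.
split=> [q Xq _|x y Ox Oy q Xq nq]; first exact: (units_submonoid (Lm Xq)).1.
by apply: (units_submonoid (Lm Xq)).2; [exact: Ox | exact: Oy].
Qed.

Let OV x : O x -> O x^-1.
Proof. by move=> Ox q Xq nq; apply: unitsV; exact: Ox. Qed.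

Let O_dvd x y : carrier H x -> carrier H y -> O (x * y) -> O x.
Proof.
move=> Hx Hy Oxy q Xq nq.
exact: (unitsM_l (Lm Xq) (Ls Xq Hx) (Ls Xq Hy) (Oxy q Xq nq)).
Qed.

Let O_mem x : O x -> loc p0 x -> carrier H x.
Proof.
move=> Ox Lx; apply: (mem_of_loc HwK) => q Xq.
by have [->//|nq] := pselect (q = p0); case: (Ox q Xq nq).
Qed.

Let w_ge0 x i : carrier H x -> (i < s p0)%N -> (0 <= w i x)%R.
Proof. by move=> Hx si; apply: (v_ge0 Hv Xp0 si); exact: Ls. Qed.

Let w_unit x i : units H x -> (i < s p0)%N -> w i x = 0%R.
Proof. by move=> [Hx Hx'] si; apply: (v_unit Hv Xp0 si); split; exact: Ls. Qed.

Let O_unit x i : carrier H x -> O x -> (i < s p0)%N -> w i x = 0%R -> units H x.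
Proof.
move=> Hx Ox si w0; split=> //; apply: O_mem; first exact: OV.
by case: (v_eq0 Hv Xp0 si (Ls Xp0 Hx) w0).
Qed.

Let O_pos x i : carrier H x -> O x -> ~ units H x -> (i < s p0)%N -> (0 < w i x)%R.
Proof.
move=> Hx Ox nU si; have := w_ge0 Hx si; rewrite Order.POrderTheory.le_eqVlt.
by move=> /orP[/eqP w0|//]; case: nU; exact: O_unit si (esym w0).
Qed.

Let H_pos x : O x -> (forall i, (i < s p0)%N -> (0 < w i x)%R) ->
  carrier H x /\ ~ units H x.
Proof.
move=> Ox wx; have Hx : carrier H x by apply: O_mem => //; exact: loc_seminormal.
by split=> // U; have := wx 0%N s0; rewrite w_unit.
Qed.

Let regular_element (k : nat -> int) : exists n theta, [/\ (0 < n)%N, O theta &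
  forall i, (i < s p0)%N -> w i theta = (n%:Z * k i)%R].
Proof.
have [f wf] := valued_surj (Hv Xp0) k.
have [n [theta [n0 U Ot]]] := local_power HwK Hv f Xp0 Cfin.
exists n, theta; split=> // i si.
by have := v_unit Hv Xp0 si U; rewrite (vM Hv) // (vV Hv) // (vX Hv) // wf // /w;
  lia.
Qed.

Let large (K : nat -> int) : exists N : nat,
  forall i, (i < s p0)%N -> (K i <= N%:Z)%R.
Proof.
exists (\sum_(i < s p0) `|K i|)%N => i si.
have : (`|K i| <= \sum_(i < s p0) `|K i|)%N by rewrite (bigD1 (Ordinal si)) //=
  leq_addr.
lia.
Qed.

(** Multiplying by [theta], which is not in [H], raises all valuations except the one at index 0. So
    if [w 0 t] left a nonzero remainder modulo [w 0 c], then t theta^N / c^j with N large would be a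
    nonunit of [H] contradicting the minimality of [c]. *)
Lemma minimal_local_element : exists c theta, [/\ carrier H c, O c, ~ units H c,
  O theta /\ w 0 theta = 0%R /\ (forall i, (0 < i < s p0)%N -> (0 < w i theta)%R) &
  (forall t, carrier H t -> O t -> ~ units H t -> (w 0 c <= w 0 t)%R) /\
  forall t, carrier H t -> O t -> exists j : nat, w 0 t = (j%:Z * w 0 c)%R].
Proof.
have [n1 [t1 [n10 Ot1 wt1]]] := regular_element (fun=> 1%R).
have [n2 [th [n20 Oth wth]]] := regular_element
  (fun i => if i == 0%N then 0%R else 1%R).
have [Ht1 nUt1] : carrier H t1 /\ ~ units H t1.
  by apply: H_pos => // i si; rewrite wt1 //; lia.
have [c [[Hc Oc nUc] cmin]] : exists c, [/\ carrier H c, O c & ~ units H c] /\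
    forall t, [/\ carrier H t, O t & ~ units H t] -> (w 0 c <= w 0 t)%R.
  have ex : exists n, `[< exists x, [/\ carrier H x,
    O x & ~ units H x] /\ `|w 0 x|%N = n >].
    by exists `|w 0 t1|%N; apply/asboolP; exists t1.
  have := ex_minnP ex; case=> n /asboolP[x [Px <-]] nmin; exists x; split=> // t Pt.
  have : (`|w 0 x| <= `|w 0 t|)%N by apply: nmin; apply/asboolP; exists t.
  have [Hx _ _] := Px; have [Ht _ _] := Pt.
  have := w_ge0 Hx s0; have := w_ge0 Ht s0; lia.
have th0 : w 0 th = 0%R by rewrite wth // GRing.mulr0.
have thi i : (0 < i < s p0)%N -> (0 < w i th)%R.
  by move=> /andP[i0 si]; rewrite wth //; case: eqP => [E|_]; lia.
exists c, th; split=> //; split=> [t Ht Ot nU|t Ht Ot]; first exact: cmin.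
have c0 := O_pos Hc Oc nUc s0; have t0 := w_ge0 Ht s0.
pose j := (`|w 0 t| %/ `|w 0 c|)%N; exists j.
have tj : (w 0 t = j%:Z * w 0 c + (`|w 0 t| %% `|w 0 c|)%:Z)%R.
  by have := divn_eq `|w 0 t| `|w 0 c|; rewrite -/j; lia.
have [r0|r0] := posnP (`|w 0 t| %% `|w 0 c|)%N; first by rewrite tj r0; lia.
have [N NP] := large (fun i => 1 + j%:Z * w i c)%R.
have Ox : O (t * th ^+ N / c ^+ j).
  apply: Om.2; last by apply: OV; exact: (submonoidX Om).
  by apply: Om.2 => //; exact: (submonoidX Om).
have wx i : w i (t * th ^+ N / c ^+ j)%g = (w i t + N%:Z * w i th - j%:Z * w i c)%R.
  by rewrite !wM wV !wX.
have [Hx nUx] : carrier H (t * th ^+ N / c ^+ j) /\ ~ units H (t * th ^+ N / c ^+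
  j).
  apply: H_pos => // i si; rewrite wx; have [i0|i0] := posnP i.
    by rewrite i0 th0; lia.
  have := thi i; rewrite i0 si => /(_ isT); have := w_ge0 Ht si; have := NP i si;
    nia.
have := cmin _ (And3 Hx Ox nUx); rewrite wx th0.
have : (`|w 0 t| %% `|w 0 c| < `|w 0 c|)%N by rewrite ltn_mod; lia.
lia.
Qed.

(** The factor [u] is allowed because the property is applied to [a * b], with [a] in [O]. *)
Let splits b := forall t t' u, carrier H t -> carrier H t' -> O u ->
  b * u = t * t' -> O t \/ O t'.

(* An element with prescribed valuations at [p0], divisible by at most one
   further prime, and to first order only,
     so that it does not split outside [p0]. *)
Lemma splitting_element (k : nat -> int) :
  (forall i, (i < s p0)%N -> (0 < k i)%R) ->
  exists b, [/\ carrier H b, forall i, (i < s p0)%N -> w i b = k i & splits b].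
Proof.
move=> k0; have [f wf] := valued_surj (Hv Xp0) k.
have [b [p [Xp reg np U [vb Ub]]]] := local_element HwK Hv f Xp0 cp0 GP.
have wb i : (i < s p0)%N -> w i b = k i.
  move=> si; have := v_unit Hv Xp0 si U.
  by rewrite (vM Hv) // (vV Hv) // wf // /w; lia.
have s1 := rank_regular Hm Hq HwK Hv Xp reg; have sp : (0 < s p)%N by rewrite s1.
exists b; split=> //.
  apply: (mem_of_loc HwK) => q Xq; have [->|nq0] := pselect (q = p0).
    by apply: loc_seminormal => // i si; rewrite -/(w i b) wb //; exact: k0.
  have [->|nq] := pselect (q = p); last by case: (Ub q Xq nq0 nq).
  by apply: (loc_regular Hm Hq HwK Hv Xp reg) => i; rewrite s1; case: i => // _;
    rewrite vb.
move=> t t' u Ht Ht' Ou E.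
have Oth x y : carrier H x -> carrier H y -> b * u = x * y -> v p 0 x = 0%R -> O x.
  move=> Hx Hy Exy vx q Xq nq0; have [Eq|nq] := pselect (q = p).
    by subst q; exact: (v_eq0 Hv Xp sp (Ls Xp Hx) vx).
  apply: (unitsM_l (Lm Xq) (Ls Xq Hx) (Ls Xq Hy)); rewrite -Exy.
  by apply: (units_submonoid (Lm Xq)).2; [exact: Ub | exact: Ou].
have vt := v_ge0 Hv Xp sp (Ls Xp Ht); have vt' := v_ge0 Hv Xp sp (Ls Xp Ht').
have : (v p 0 t + v p 0 t' = 1)%R.
  by rewrite -(vM Hv) // -E (vM Hv) // vb (v_unit Hv Xp sp (Ou p Xp np))
    GRing.addr0.
move=> vE; have [t0|t'0] : v p 0 t = 0%R \/ v p 0 t' = 0%R by lia.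
  by left; exact: (Oth t t').
by right; apply: (Oth t' t) => //; rewrite E mulgC.
Qed.

(** As [k 1] is 1, one of any two factors of [b] has valuation 0 at index 1 and is thus a unit at
    [p0]. Removing such factors changes no valuation at [p0] and preserves splitting, so a divisor
    with these properties and minimal length function is an atom. *)
Lemma splitting_atom (k : nat -> int) :
  (forall i, (i < s p0)%N -> (0 < k i)%R) -> k 1%N = 1%R ->
  exists b, [/\ atom H b, forall i, (i < s p0)%N -> w i b = k i & splits b].
Proof.
move=> k0 k1; have [b0 [Hb0 wb0 Sb0]] := splitting_element k0.
have [l [lM l0 lpos]] := length_function Hm HwK Hv Hb0.
pose good b := [/\ carrier H b, forall i, (i < s p0)%N -> w i b = k i, splits b &
  exists y, carrier H y /\ b0 = b * y].
have [b [[Hb wb Sb [y [Hy Eb]]] bmin]] : exists b, good b /\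
    forall t, good t -> (`|l b| <= `|l t|)%N.
  have ex : exists n, `[< exists x, good x /\ `|l x|%N = n >].
    exists `|l b0|%N; apply/asboolP; exists b0; split=> //; split=> //.
    by exists 1; rewrite mulg1; split=> //; exact: Hm.1.
  have := ex_minnP ex; case=> n /asboolP[x [Px <-]] nmin; exists x; split=> // t Pt.
  by apply: nmin; apply/asboolP; exists t.
have key t t' : carrier H t -> carrier H t' -> b = t * t' -> w 1 t = 0%R ->
  units H t.
  move=> Ht Ht' E wt; apply: contrapT => nU.
  have Ut : units (loc p0) t by exact: (v_eq0 Hv Xp0 rank_p0 (Ls Xp0 Ht) wt).
  have lt : (0 < l t)%R.
    by apply: (lpos t (t' * y)) => //; [exact: Hm.2 | rewrite Eb E mulgA].
  have := bmin t'; rewrite E lM => H1.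
  suff /H1 : good t' by have := l0 _ Ht'; lia.
  split=> //.
  - move=> i si; rewrite -wb // E wM.
    by rewrite [w i t](v_unit Hv Xp0 si Ut) GRing.add0r.
  - move=> x x' u Hx Hx' Ou Ex.
    have [||Otx|] := Sb (x * t) x' u _ Hx' Ou; [exact: Hm.2 | | | by right].
      by rewrite E -mulgA Ex; abelg.
    by left; exact: O_dvd Hx Ht Otx.
  - by exists (t * y); split; [exact: Hm.2 | rewrite Eb E; abelg].
exists b; split=> //; split=> //.
  by move=> U; have := w_unit U rank_p0; rewrite wb // k1.
move=> t t' Ht Ht' E.
have wE : (w 1 t + w 1 t' = 1)%R by rewrite -wM -E wb.
have := w_ge0 Ht rank_p0; have := w_ge0 Ht' rank_p0 => wt' wt.
have [t0|t'0] : w 1 t = 0%R \/ w 1 t' = 0%R by lia.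
  by left; exact: key E t0.
by right; apply: (key t' t) => //; rewrite mulgC.
Qed.

Lemma lengths_two_to_n n : (2 <= n)%N -> exists h,
  [/\ carrier H h, lengths H h 2%N, lengths H h n &
    forall k, lengths H h k -> (2 <= k <= n)%N].
Proof.
move=> n2; have [c [th [Hc Oc nUc [Oth [th0 thi]] [cmin cmul]]]] :=
  minimal_local_element.
have c0 := O_pos Hc Oc nUc s0.
(* Together with an atom [a] having [w 0 a = w 0 c], this gives [a * b] the value [n * w 0 c]. *)
pose k i := (if i == 0%N then (n.-1)%:Z * w 0 c else 1)%R.
have [||b [bA wb Sb]] := @splitting_atom k; [|by []|].
  by move=> i si; rewrite /k; case: eqP => // _; nia.
(* [N] is large enough for [a * b] to remain positive at all indices after division by
   [c ^+ n.-1]. *)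
have [N NP] := large (fun i => n%:Z * w i c)%R.
pose a := c * th ^+ N.
have Oa : O a by apply: Om.2 => //; exact: (submonoidX Om).
have wa i : w i a = (w i c + N%:Z * w i th)%R by rewrite wM wX.
have wa0 : w 0 a = w 0 c by rewrite wa th0 GRing.mulr0 GRing.addr0.
have [Ha nUa] : carrier H a /\ ~ units H a.
  apply: H_pos => // i si; rewrite wa; have [i0|i0] := posnP i.
    by rewrite i0 th0; lia.
  have := thi i; rewrite i0 si => /(_ isT); have := O_pos Hc Oc nUc si; nia.
have aA : atom H a.
  split=> // x y Hx Hy E; apply: contrapT => /not_orP[nUx nUy].
  have Ox : O x by apply: (O_dvd Hx Hy); rewrite -E.
  have Oy : O y by apply: (O_dvd Hy Hx); rewrite mulgC -E.
  have := cmin x Hx Ox nUx; have := cmin y Hy Oy nUy.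
  have : w 0 a = (w 0 x + w 0 y)%R by rewrite E wM.
  by lia.
have [Hb nUb bI] := bA.
have Hab : carrier H (a * b) by exact: Hm.2.
have wab : w 0 (a * b) = (n%:Z * w 0 c)%R.
  by rewrite wM wa0 wb // /k eqxx; nia.
(* If [t] is in [O], minimality of [c] applies. Otherwise the cofactor is in [O], so [w 0 t] is a
   multiple of [w 0 c]. The multiple 0 is impossible: [t] would be a unit at [p0], and b = t (b / t)
   would split the atom [b] into nonunits. *)
have factor t t' : carrier H t -> carrier H t' -> a * b = t * t' -> ~ units H t ->
    (w 0 c <= w 0 t)%R.
  move=> Ht Ht' E nUt.
  have Eba : b * a = t * t' by rewrite mulgC.
  have [Ot|Ot'] := Sb t t' a Ht Ht' Oa Eba; first exact: cmin.
  have [j wj] := cmul t' Ht' Ot'.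
  have wt : (w 0 t = (n%:Z - j%:Z) * w 0 c)%R.
    have : (w 0 t + w 0 t' = n%:Z * w 0 c)%R by rewrite -wM -E.
    by rewrite wj; nia.
  have := w_ge0 Ht s0; rewrite Order.POrderTheory.le_eqVlt => /orP[/eqP wt0|];
    last first.
    rewrite wt; move: (n%:Z - j%:Z)%R => d.
    have [d1|d0] : (1 <= d)%R \/ (d <= 0)%R by lia.
      by nia.
    by nia.
  have Ut : units (loc p0) t by exact: (v_eq0 Hv Xp0 s0 (Ls Xp0 Ht) (esym wt0)).
  have Obt : O (b / t).
    have -> : b / t = t' / a.
      have -> : b = t * t' / a by rewrite -E; abelg.
      abelg.
    by apply: Om.2 => //; exact: OV.
  have wbt i : (i < s p0)%N -> w i (b / t) = k i.
    move=> si; rewrite wM wV wb //.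
    by rewrite [w i t](v_unit Hv Xp0 si Ut); lia.
  have [Hbt nUbt] : carrier H (b / t) /\ ~ units H (b / t).
    by apply: H_pos => // i si; rewrite wbt // /k; case: eqP => // _; nia.
  have [|//|//] := bI t (b / t) Ht Hbt.
  by rewrite mulgC mulgVK.
have L2 : lengths H (a * b) 2%N.
  by rewrite -[2%N]/(1 + 1)%N; apply: lengthsM => //; apply/lengths1.
have upper l : lengths H (a * b) l -> (l <= n)%N.
  move=> /(lengthsP Hm)[e [r [[Ue rA E] <-]]].
  have rw x : x \in r -> (w 0 c <= w 0 x)%R.
    move=> xr; have [Hx nUx _] := rA x xr.
    apply: (factor x (e * \prod_(y <- rem x r) y)) => //.
      apply: Hm.2; first by case: Ue.
      by apply: prod_atoms_sub => // y /mem_rem /rA.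
    by rewrite E [in LHS](big_rem x) //= mulgCA.
  have : (n%:Z * w 0 c = \sum_(x <- r) w 0 x)%R.
    rewrite -wab E wM (w_unit Ue s0) GRing.add0r.
    by apply: intmor_prod => x y; exact: wM.
  have : ((size r)%:Z * w 0 c <= \sum_(x <- r) w 0 x)%R.
    elim: (r) rw => [|x r' IHr] rw; first by rewrite big_nil GRing.mul0r.
    have rw' y : y \in r' -> (w 0 c <= w 0 y)%R by move=> yr; apply: rw;
      rewrite inE yr orbT.
    have := rw x (mem_head _ _); have := IHr rw'; rewrite big_cons /=.
    by set S := (\sum_(y <- r') _)%R; lia.
  by move=> le E'; move: le; rewrite -E'; nia.
have lower l : lengths H (a * b) l -> (2 <= l)%N.
  case: l => [|[|l]] //.
    by move=> /lengths_unit /(unitsM_l Hm Ha Hb).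
  by move=> /(lengths1 Hm)[_ _ /(_ a b Ha Hb erefl)[]].
(* The long factorization consists of n - 1 copies of [c] and this remainder, for which
   [w 0 r = w 0 c]. *)
pose r := a * b / c ^+ n.-1.
have [Hr nUr] : carrier H r /\ ~ units H r.
  have wr i : (i < s p0)%N -> (0 < w i r)%R.
    move=> si; rewrite /r wM wV wX wM wa wb // /k; have [->|i0] := posnP i.
      by rewrite th0; nia.
    have := thi i; rewrite i0 si => /(_ isT); have := NP i si.
    by have := O_pos Hc Oc nUc si; nia.
  have Hr : carrier H r.
    apply: (mem_of_loc HwK) => q Xq; have [->|nq] := pselect (q = p0).
      exact: loc_seminormal.
    have -> : r = b * (a / c ^+ n.-1) by rewrite /r; abelg.
    apply: (Lm Xq).2; first exact: Ls.
    have [] : units (loc q) (a / c ^+ n.-1) => //.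
    by apply: (Om.2 _ _ Oa) => //; apply: OV; exact: (submonoidX Om).
  by split=> // U; have := wr 0%N s0; rewrite w_unit.
have [lc Lc] := lengths_nonempty Hm (length_function Hm HwK Hv) Hc.
have [lr Lr] := lengths_nonempty Hm (length_function Hm HwK Hv) Hr.
have Ln := lengthsM Hm (lengthsX Hm n.-1 Lc) Lr.
have Er : c ^+ n.-1 * r = a * b by rewrite /r; abelg.
rewrite Er in Ln.
have lc0 : (0 < lc)%N by case: lc Lc {Ln} => // /lengths_unit.
have lr0 : (0 < lr)%N by case: lr Lr {Ln} => // /lengths_unit.
(* No irreducibility of [c] or [r] has been shown: their lengths are positive, and the upper bound
   [n] forces equality. *)
have En : (n.-1 * lc + lr)%N = n by have := upper _ Ln; nia.
exists (a * b); split=> //; first by rewrite -En.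
by move=> l Ll; rewrite lower // upper.
Qed.

End SeminormalHigherRank.

(** * Rational elasticities and the two assertions *)

Lemma rat_fraction (q : rat) : (1 < q)%R ->
  exists x y : nat, [/\ (0 < y)%N, (y < x)%N & q = (x%:R / y%:R)%R].
Proof.
move=> q1; have d0 := denq_gt0 q.
have E : q = ((numq q)%:~R / (denq q)%:~R)%R by rewrite divq_num_den.
have nd : (denq q < numq q)%R.
  move: q1; rewrite {1}E Num.Theory.ltr_pdivlMr ?ltr0z //.
  by rewrite GRing.mul1r ltr_int.
exists `|numq q|%N, `|denq q|%N; split; [lia | lia |].
by rewrite {1}E !natr_absz !Num.Theory.gtr0_norm //;
  exact: Order.POrderTheory.lt_trans nd.
Qed.

Lemma ltr_natfrac (x y m M : nat) : (0 < y)%N -> (0 < m)%N ->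
  (x%:R / y%:R < M%:R / m%:R :> rat)%R = (x * m < y * M)%N.
Proof.
move=> y0 m0; rewrite Num.Theory.ltr_pdivrMr ?Num.Theory.ltr0n //.
rewrite GRing.mulrAC Num.Theory.ltr_pdivlMr ?Num.Theory.ltr0n //.
by rewrite -!GRing.natrM Num.Theory.ltr_nat [(M * y)%N]mulnC.
Qed.

Lemma eqr_natfrac (x y m M : nat) : (0 < y)%N -> (0 < m)%N -> (y * M = x * m)%N ->
  (M%:R / m%:R = x%:R / y%:R :> rat)%R.
Proof.
move=> y0 m0 E; apply/eqP; rewrite GRing.eqr_div ?Num.Theory.pnatr_eq0 -?lt0n //.
by rewrite -!GRing.natrM mulnC E.
Qed.

Theorem theorem4p2 (R : realType) (G : comGroupType) (H : monoid_in G)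
  (H_v_noetherian : v_noetherian H)
  (H_weakly_Krull : weakly_Krull H)
  (conductor_neq0 : conductor H !=set0)
  (conductor_proper : conductor H `<` H)
  (H_fin_primary : forall p, min_primes H p ->
    finitely_primary (localization H p)) :
  let Hhat := complete_integral_closure H in
  let Pstar := [set p | min_primes H p /\ conductor H `<=` p] in
  let P := min_primes H `\` Pstar in
  let GP := classes_of H P in
  let pi := fun p : set G => p `&` H in
  P !=set0 ->
  (set_bij (min_primes Hhat) (min_primes H) pi ->
   (forall p, min_primes H p ->
      finite_set
        (cosets (units (complete_integral_closure (localization H p)))
                (units (localization H p)))) ->
   zero_sum_sequences GP <> [set mset0] ->
   fully_elastic R H)
  /\
  (~ set_bij (min_primes Hhat) (min_primes H) pi ->
   seminormal H ->
   GP = setT ->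
   finite_set [set: v_class_group H] ->
   elasticity R H = +oo%E /\ fully_elastic R H).
Proof.
move=> Hhat Pstar P GP pi _.
have Hm := carrier_submonoid H; have Hq := carrier_quotient H.
have ex p : exists d : nat * nat * (nat -> G -> int), min_primes H p ->
    valued (localization H p) d.1.1 d.1.2 d.2.
  have [Xp|nX] := pselect (min_primes H p);
    last by exists (0%N, 0%N, fun _ _ => 0%R).
  have Lq := quotient_group_sub (loc_sub Hm (min_prime_prime Xp)) Hq.
  have [s [al [v Hv]]] := finitely_primary_valued Lq (H_fin_primary p Xp).
  by exists (s, al, v).
have [d Hv] := choice ex.
have bijP := contraction_bij Hm Hq H_weakly_Krull Hv.
have lf := length_function Hm H_weakly_Krull Hv.
split=> [/bijP s1 fin_cosets nB q q1|nbij Hsn GPT Cfin].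
- have [x [y [y0 yx qE]]] := rat_fraction q1.
  move=> /ereal_sup_gt[_ [_ [a Ha <-] <-]].
  rewrite lte_fin ltr_rat => qa.
  have [m [M [Lm LM mM]]] := lengths_minmax Hm lf Ha.
  (* A unit has set of lengths {0}, of elasticity 1 by convention, which is below [q]. *)
  have m0 : (0 < m)%N.
    rewrite lt0n; apply/eqP => E; move: Lm; rewrite E => /lengths_unit U.
    move: qa; rewrite /elasticity_of_set; case: asboolP => [_|[]].
      by move=> /(Order.POrderTheory.lt_trans q1); rewrite Order.POrderTheory.ltxx.
    by apply/seteqP; split=> [k /(lengths_of_unit U)//|_ ->]; apply/lengths_unit.
  move: qa; rewrite (elasticity_of_setE LM Lm m0 mM) qE ltr_natfrac // => qa.
  have [b0 [Hb0 nUb0 breg]] := regular_nonunit H_weakly_Krull Hv nB.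
  have [A [AA lenA]] := absolutely_irreducible_atom Hm Hq H_weakly_Krull Hv Hb0
    nUb0 breg.
  have HaA : carrier H (a * A) by apply: Hm.2 => //; case: AA.
  have wl p : min_primes H p ->
      wqo_on (localization H p) (fun x y => localization H p (y / x)).
    by move=> Xp; exact: (loc_wqo Hm Hv Xp (s1 p Xp) (fin_cosets p Xp)).
  have [N [u [uA ufin]]] := finitely_many_atoms Hm H_weakly_Krull HaA wl.
  have [b [m' [M' [Hb Lm' LM' m'0 [E mM']]]]] :=
    elasticity_interpolation Hm lf Ha AA lenA uA ufin y0 yx LM Lm qa.
  exists (lengths H b); split; first by exists b.
  by rewrite (elasticity_of_setE LM' Lm' m'0 mM'); exact: eqr_natfrac.
- have [p0 Xp0 rank2] : exists2 p0, min_primes H p0 & (1 < (d p0).1.1)%N.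
    apply: contrapT => no; apply: nbij; apply/bijP => p Xp.
    have s0 := valued_rank (Hv p Xp); have [|s2] := leqP (d p).1.1 1%N;
      first by lia.
    by case: no; exists p.
  have two n : (2 <= n)%N ->
    _ := lengths_two_to_n H_weakly_Krull Hv Hsn Xp0 rank2 GPT Cfin (n := n).
  split.
    apply/eq_infty => t.
    have [n tn] : exists n : nat, (t <= n%:R)%R.
      exists (Num.truncn `|t|).+1;
        apply: Order.POrderTheory.le_trans (Num.Theory.ler_norm _) _.
      by apply: Order.POrderTheory.ltW; exact: Num.Theory.truncnS_gt.
    have [|h [Hh L2 Ln mM]] := two (2 * n.+1)%N; first by lia.
    apply: (@Order.POrderTheory.le_trans _ _ (ratr (elasticity_of_set (lengths H
      h)))%:E).
      rewrite (elasticity_of_setE Ln L2 _ mM) // GRing.natrM GRing.mulrAC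
        GRing.divff ?Num.Theory.pnatr_eq0 //.
      rewrite GRing.mul1r ratr_nat lee_fin; apply: Order.POrderTheory.le_trans tn _.
      by rewrite Num.Theory.ler_nat.
    by apply: ereal_sup_ubound; exists (lengths H h) => //; exists h.
  move=> q q1 _; have [x [y [y0 yx qE]]] := rat_fraction q1.
  have GP0 : classes_of H P 0%R by rewrite -/GP GPT.
  have [z zP] := prime_elt_of_class0 GP0.
  (* With j = 2y - 2 prime factors added, the extremal lengths become 2y and 2x. Doubling the
     fraction keeps [j] nonnegative when y = 1. *)
  have [|h [Hh L2 Ln mM]] := two (2 + 2 * (x - y))%N; first by lia.
  pose j := (2 * y - 2)%N; have Hz : carrier H z by case: zP.
  have L2' := prime_elt_lengthsX_mem Hm j zP L2.
  have Ln' := prime_elt_lengthsX_mem Hm j zP Ln.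
  have mM' k : lengths H (z ^+ j * h) k -> (j + 2 <= k <= j + (2 + 2 * (x - y)))%N.
    by move=> /(prime_elt_lengthsX Hm zP Hh)[jk /mM]; lia.
  exists (lengths H (z ^+ j * h)); split.
    by exists (z ^+ j * h) => //; apply: Hm.2 => //; exact: submonoidX.
  rewrite (elasticity_of_setE Ln' L2' _ mM') ?addn2 // qE.
  by apply: eqr_natfrac => //; rewrite /j; nia.
Qed.
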